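(* Let $a>b>0$ and consider the magic billiard with flipping over the short axis in the table bounded by the ellipse $\mathcal{E}:\ \frac{x^2}{a}+\frac{y^2}{b}=1$. Consider a trajectory of this billiard with caustic $\mathcal{C}_\beta$. Let $n$ be a positive integer. The trajectory is $n$-periodic if and only if $n$ is even and $nQ_0\sim nQ_\infty$. Here $Q_0$, $Q_\infty$ denote the points with coordinates $(0,\sqrt{ab\beta})$, $(\infty,\infty)$ on the elliptic curve $y^2=(a-x)(b-x)(\beta-x)$, and $\sim$ denotes linear equivalence of divisors on that curve.
   Context: Confocal family: $\mathcal{C}_\lambda:\ \frac{x^2}{a-\lambda}+\frac{y^2}{b-\lambda}=1$, so $\mathcal{E}=\mathcal{C}_0$; $\mathcal{C}_\lambda$ is an ellipse for $\lambda<b$ and a hyperbola for $b<\lambda<a$. Magic billiard with flipping over the short axis: let $D$ be the closed domain bounded by $\mathcal{E}$, and let $\varphi$ be the reflection of the plane with respect to the shorter axis of $\mathcal{E}$, $\varphi(x,y)=(-x,y)$. A particle moves with unit speed along straight segments inside $D$. When it hits $\mathcal{E}$ at a point $A$ with velocity $\vec v$, it continues from the point $\varphi(A)$ with velocity $\varphi^*(\vec v)=d\varphi(\rho_A(\vec v))$, where $\rho_A$ is the usual billiard reflection (reflection of vectors with respect to the tangent line to $\mathcal{E}$ at $A$). Caustic: each trajectory has a unique conic $\mathcal{C}_\beta$ of the confocal family such that the lines containing the segments of the trajectory are all tangent to $\mathcal{C}_\beta$; it is called the caustic of the trajectory. The caustic is nondegenerate, i.e. $\beta\in(0,b)\cup(b,a)$,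 so that the curve is nonsingular; its projective closure has one point $Q_\infty$ at infinity. $n$-periodic: after $n$ consecutive hits at the boundary the particle returns to its initial position and velocity ($n$ is not required to be the minimal such number). *)

(* Defs.v *)
From HB Require Import structures.
From mathcomp Require Import all_boot all_order all_algebra all_field.
From mathcomp Require Import reals.
From mathcomp Require Import complex.
From mathcomp Require Import freeg.

Set Implicit Arguments.
Unset Strict Implicit.
Unset Printing Implicit Defensive.

Import Order.TTheory GRing.Theory Num.Theory.

Local Open Scope ring_scope.
Local Open Scope complex_scope.

Section Billiard.
Context {R : realType}.

Definition plane : Type := (R * R)%type.

Implicit Types (p v A : plane) (a b c d s : R).

Definition dot v w : R := v.1 * w.1 + v.2 * w.2.

Definition advance p s v : plane := (p.1 + s * v.1, p.2 + s * v.2).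

Definition ellipse_form a b p : R := p.1 ^+ 2 / a + p.2 ^+ 2 / b.

(* A normal vector at A to x^2/a + y^2/b = 1 (half of the gradient). *)
Definition normal a b A : plane := (A.1 / a, A.2 / b).

(* rho_A: reflection of vectors with respect to the tangent line at A. *)
Definition reflect_at a b A v : plane :=
  let N := normal a b A in advance v (- (2 * dot v N / dot N N)) N.

(* phi; being linear, it is also its own differential. *)
Definition flip p : plane := (- p.1, p.2).

(* A trajectory, cut at its hits.  The particle starts at [pos 0] in the closed
   table with velocity [vel 0]; for k >= 1, [pos k] and [vel k] are the position
   and the velocity with which it continues after its k-th hit, and [flight k]
   is the time it then travels before the next hit.  The starting point is
   either interior or on the boundary with velocity pointing inside. *)
Record magic_trajectory a b := MagicTrajectory {
  pos : nat -> plane;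
  vel : nat -> plane;
  flight : nat -> R;
  start_in_table : ellipse_form a b (pos 0) <= 1;
  unit_speed : forall k, dot (vel k) (vel k) = 1;
  flight_gt0 : forall k, 0 < flight k;
  flight_interior : forall k s, 0 < s < flight k ->
    ellipse_form a b (advance (pos k) s (vel k)) < 1;
  flight_hits : forall k,
    ellipse_form a b (advance (pos k) (flight k) (vel k)) = 1;
  pos_after_hit : forall k,
    pos k.+1 = flip (advance (pos k) (flight k) (vel k));
  vel_after_hit : forall k,
    vel k.+1 =
      flip (reflect_at a b (advance (pos k) (flight k) (vel k)) (vel k))
}.

(* Between its n-th and (n+1)-st hits the particle is at its initial position
   with its initial velocity.  When [pos 0] is on the boundary, s is 0. *)
Definition n_periodic a b (T : magic_trajectory a b) (n : nat) : Prop :=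
  exists s, [/\ 0 <= s < flight T n,
    advance (pos T n) s (vel T n) = pos T 0 & vel T n = vel T 0].

(* The line {p + s v} is the tangent at some point (X : Y : Z) to the projective
   closure X^2/c + Y^2/d = Z^2 of the conic x^2/c + y^2/d = 1.  The contact point
   may be at infinity: a trajectory through the centre of the table can lie on
   the asymptotes of its caustic. *)
Definition tangent_to_conic c d p v : Prop :=
  exists X Y Z : R, [/\ (X, Y, Z) != (0, 0, 0),
    X ^+ 2 / c + Y ^+ 2 / d = Z ^+ 2
    & forall s, let q := advance p s v in q.1 * X / c + q.2 * Y / d = Z].

Definition has_caustic a b (T : magic_trajectory a b) (beta : R) : Prop :=
  forall k, tangent_to_conic (a - beta) (b - beta) (pos T k) (vel T k).

End Billiard.

Definition cubic (K : nzRingType) (e1 e2 e3 : K) : {poly K} :=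
  (e1%:P - 'X) * (e2%:P - 'X) * (e3%:P - 'X).

(* Y^2 - (e1 - x)(e2 - x)(e3 - x), as a polynomial in Y over K(x). *)
Definition curve_poly (K : closedFieldType) (e1 e2 e3 : K) :
    {poly {fraction {poly K}}} :=
  'X^2 - (tofrac (cubic e1 e2 e3))%:P.

Lemma size_cubic (K : closedFieldType) (e1 e2 e3 : K) :
  size (cubic e1 e2 e3) = 4.
Proof.
have s (e : K) : size (e%:P - 'X) = 2 by rewrite -opprB size_polyN size_XsubC.
have nz (e : K) : e%:P - 'X != 0 by rewrite -size_poly_gt0 s.
by rewrite /cubic !size_mul ?mulf_neq0 ?s.
Qed.

Lemma curve_poly_monic_irreducible (K : closedFieldType) (e1 e2 e3 : K) :
  monic_irreducible_poly (curve_poly e1 e2 e3).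
Proof.
have sz : size (curve_poly e1 e2 e3) = 3.
  by rewrite /curve_poly size_polyDl ?size_polyXn // size_polyN;
     apply: leq_ltn_trans (size_polyC_leq1 _) _.
split; last first.
  by rewrite monicE /lead_coef sz /curve_poly coefB coefXn coefC subr0.
apply: cubic_irreducible => [|r]; first by rewrite sz.
apply/negP; rewrite rootE /curve_poly !hornerE subr_eq0 => /eqP r2.
have [u [v [v0 rE]]] : exists u v, v != 0 /\ r * tofrac v = tofrac u.
  pose x : {ratio {poly K}} := repr (r : FracField.type {poly K}).
  have rx : r = \pi_(FracField.type {poly K})%qT x by rewrite reprK.
  exists (frac x).1, (frac x).2; split; first exact: denom_ratioP.
  rewrite rx; unlock FracField.tofrac; rewrite -[LHS]FracField.pi_mul.
  apply/eqmodP; rewrite /= FracField.equivfE /FracField.mulf.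
  rewrite !numden_Ratio ?mulf_neq0 ?oner_eq0 ?denom_ratioP //.
  by rewrite !mulr1 mulrC.
have /eqP: cubic e1 e2 e3 * v ^+ 2 == u ^+ 2.
  by rewrite -tofrac_eq tofracM !tofracXn -rE exprMn r2.
move/(congr1 (fun p : {poly K} => odd (size p))).
have c0 : cubic e1 e2 e3 != 0 by rewrite -size_poly_gt0 size_cubic.
have u0 : u != 0.
  apply: contraNneq c0 => u0; move: r2; rewrite -tofrac_eq0 => <-.
  have/eqP: r * tofrac v = 0 by rewrite rE u0 tofrac0.
  by rewrite mulf_eq0 tofrac_eq0 (negPf v0) orbF => /eqP ->; rewrite expr0n.
rewrite size_mul ?expf_neq0 // size_cubic !expr2 !size_mul //.
move: u0 v0; rewrite -!size_poly_gt0.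
case: (size u) => // i _; case: (size v) => // j _.
by rewrite !addSn !addnS /= !oddD !addbb.
Qed.

Section Curve.
Context {K : closedFieldType} (e1 e2 e3 : K).

Definition function_field : fieldType :=
  {poly %/ curve_poly e1 e2 e3 with curve_poly_monic_irreducible e1 e2 e3}.

Definition ff_rat (r : {fraction {poly K}}) : function_field :=
  in_qpoly (curve_poly e1 e2 e3) r%:P.
Definition ff_const (c : K) : function_field := ff_rat (tofrac c%:P).
Definition ff_x : function_field := ff_rat (tofrac 'X).
Definition ff_y : function_field := in_qpoly (curve_poly e1 e2 e3) 'X.

(* [Some (x, y)] is an affine point, [None] the point at infinity (0 : 1 : 0). *)
Definition on_curve (P : option (K * K)) : bool :=
  if P is Some (x, y) then y ^+ 2 == (e1 - x) * (e2 - x) * (e3 - x) else true.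

Definition curve_point : choiceType := {P | on_curve P}.

Definition point_infinity : curve_point := exist on_curve None isT.

(* Affine plane charts of the projective plane: (x, y) = (X/Z, Y/Z) at the affine
   points, and (x/y, 1/y) = (X/Y, Z/Y), with origin (0 : 1 : 0), at infinity. *)
Definition chart_functions (P : curve_point) : function_field * function_field :=
  if val P is Some _ then (ff_x, ff_y) else (ff_x / ff_y, ff_y^-1).

Definition chart_coords (P : curve_point) : K * K :=
  if val P is Some xy then xy else (0, 0).

Definition eval2 {L : nzRingType} (f : K -> L) (G : {poly {poly K}})
    (uv : L * L) : L :=
  (map_poly (fun g => (map_poly f g).[uv.1]) G).[uv.2].

(* G(P), and the rational function on the curve induced by G, for a polynomial G
   in the two coordinates of the chart at P. *)
Definition value_at (P : curve_point) (G : {poly {poly K}}) : K :=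
  eval2 id G (chart_coords P).
Definition restrict_at (P : curve_point) (G : {poly {poly K}}) : function_field :=
  eval2 ff_const G (chart_functions P).

Definition local_ring (P : curve_point) (h : function_field) : Prop :=
  exists G H, value_at P H != 0 /\ h = restrict_at P G / restrict_at P H.
Definition local_max_ideal (P : curve_point) (h : function_field) : Prop :=
  exists G H, [/\ value_at P G = 0, value_at P H != 0
    & h = restrict_at P G / restrict_at P H].
Definition local_unit (P : curve_point) (h : function_field) : Prop :=
  exists G H, [/\ value_at P G != 0, value_at P H != 0
    & h = restrict_at P G / restrict_at P H].

Definition uniformizer (P : curve_point) (t : function_field) : Prop :=
  local_max_ideal P t /\
  forall h, local_max_ideal P h -> exists2 g, local_ring P g & h = t * g.

Definition has_order (P : curve_point) (h : function_field) (m : int) : Prop :=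
  exists t u, [/\ uniformizer P t, local_unit P u & h = t ^ m * u].

Definition divisor : Type := {freeg curve_point / int}.

Definition is_divisor_of (h : function_field) (D : divisor) : Prop :=
  forall P, has_order P h (coeff P D).

Definition lin_equiv (D1 D2 : divisor) : Prop :=
  exists2 h : function_field, h != 0 & is_divisor_of h (D1 - D2).

End Curve.

Section BilliardCurve.
Context {R : realType} (a b beta : R).

Definition billiard_point : choiceType := curve_point a%:C b%:C beta%:C.

Lemma on_curve_Q0 :
  on_curve a%:C b%:C beta%:C (Some (0, sqrtC (a * b * beta)%:C)).
Proof. by rewrite /= sqrtCK !subr0 !rmorphM. Qed.

(* sqrtC z is the nonnegative square root when z is a nonnegative real. *)
Definition Q0 : billiard_point :=
  exist (on_curve a%:C b%:C beta%:C) (Some (0, sqrtC (a * b * beta)%:C)) on_curve_Q0.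
Definition Qinf : billiard_point := point_infinity a%:C b%:C beta%:C.

End BilliardCurve.

(* Main.v *)
(** The lines of a trajectory are followed by the 2 x 2 matrix
    [L = (U, V; W, - U)] with [U = q(x, v)], [V = q(v, v)], [W = 1 - q(x, x)], where
    [q(x, y) = x1 y1 / (a - l) + x2 y2 / (b - l)], multiplied by [(a - l) (b - l)].
    It is unchanged by the flip, and [U^2 + V W] is the cubic
    [f = (a - l) (b - l) (beta - l)].  A flight followed by a reflection conjugates
    [L] by a matrix of determinant [l^2], so that [n] hits give a matrix [M] with
    [det M = l^(2n)] and [M L_0 = L_n M]; at [l = a] and [l = b] it maps [(v_i, - x_i)]
    to [(-a)^n] and [b^n] times its value after [n] hits.

    If the trajectory closes up, [M] (corrected by a flight) commutes with [L_0],
    hence is [p + q L_0], and [p^2 - f q^2 = l^(2n)].  On the intervals where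
    [f >= 0] the monic polynomial [p] has no zero, which forces [n] to be even and
    [p(e) = e^n] at the three roots of [f].  Then [p + l^n] and [p - l^n] are, up to
    the factor [f] in the latter, coprime squares, and their difference gives
    [l^n = r^2 - f s^2]: the function [r + s y] has divisor [n Q0 - n Qinf].
    Conversely every function with that divisor is such an [r + s y].  Its square
    [r^2 + f s^2 + 2 r s y] provides a matrix [M' = p + q L_0] of determinant
    [l^(2n)] with the same kernel as [M] at [l = 0] (after a choice of sign).
    So [M = C M'] with [C] constant, and comparing leading terms [C] is unipotent
    when [n] is even, which says that the n-th line and velocity are the initial
    ones. *)

Require Import Defs.
From HB Require Import structures.
From mathcomp Require Import all_boot all_order all_algebra all_field.
From mathcomp Require Import reals.
From mathcomp Require Import complex polyrcf.
From mathcomp Require Import freeg.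
From mathcomp Require Import zify ring lra.

Set Implicit Arguments.
Unset Strict Implicit.
Unset Printing Implicit Defensive.

Import Order.TTheory GRing.Theory Num.Theory.

Local Open Scope ring_scope.

Lemma subr_horner_factor (R : nzRingType) (p : {poly R}) c :
  exists q, p = q * ('X - c%:P) + p.[c]%:P.
Proof.
have /factor_theorem[q e] : root (p - p.[c]%:P) c by rewrite /root !hornerE subrr.
by exists q; rewrite -e subrK.
Qed.

(** * Local rings of the points of the curve *)

(** This is [eval2] bundled as a ring morphism, to which it is convertible. The outer variable of
    [{poly {poly K}}] is the second coordinate, the inner variable the first. *)
Definition eval_morph (K : nzRingType) (L : comNzRingType) (phi : {rmorphism K -> L})
    (uv : L * L) : {rmorphism {poly {poly K}} -> L} :=
  horner_morph (fun g => mulrC uv.2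
    (horner_morph (fun c => mulrC uv.1 (phi c) : GRing.comm _ _) g) : GRing.comm _ _).

Arguments eval_morph : simpl never.

Lemma eval_morphE (K : closedFieldType) (L : comNzRingType) (phi : {rmorphism K -> L}) uv G :
  eval_morph phi uv G = eval2 phi G uv.
Proof. by []. Qed.

Lemma eval_morphC (K : nzRingType) (L : comNzRingType) (phi : {rmorphism K -> L}) uv g :
  eval_morph phi uv g%:P = (map_poly phi g).[uv.1].
Proof. by rewrite /eval_morph /= horner_morphC. Qed.

Lemma eval_morphX (K : nzRingType) (L : comNzRingType) (phi : {rmorphism K -> L}) uv :
  eval_morph phi uv 'X = uv.2.
Proof. by rewrite /eval_morph /= horner_morphX. Qed.

(* The local notions of [Defs] with an arbitrary field in place of the function
   field: [rs] restricts a polynomial in the chart coordinates to the curve, and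
   [vl] is its value at the point. *)
Section PlaceDefinitions.
Context {K : closedFieldType} {L : fieldType}.
Context (rs : {poly {poly K}} -> L) (vl : {poly {poly K}} -> K).

Definition place_ring (h : L) : Prop :=
  exists G H, vl H != 0 /\ h = rs G / rs H.
Definition place_ideal (h : L) : Prop :=
  exists G H, [/\ vl G = 0, vl H != 0 & h = rs G / rs H].
Definition place_unit (h : L) : Prop :=
  exists G H, [/\ vl G != 0, vl H != 0 & h = rs G / rs H].
Definition place_uniformizer (t : L) : Prop :=
  place_ideal t /\ forall h, place_ideal h -> exists2 g, place_ring g & h = t * g.
Definition place_order (h : L) (m : int) : Prop :=
  exists t u, [/\ place_uniformizer t, place_unit u & h = t ^ m * u].

End PlaceDefinitions.

Section Place.
Context {K : closedFieldType} {L : fieldType}.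
Context (rs : {rmorphism {poly {poly K}} -> L}) (vl : {rmorphism {poly {poly K}} -> K}).

Local Notation place_ring := (place_ring rs vl).
Local Notation place_ideal := (place_ideal rs vl).
Local Notation place_unit := (place_unit rs vl).
Local Notation place_uniformizer := (place_uniformizer rs vl).
Local Notation place_order := (place_order rs vl).

Lemma place_unit_poly G : vl G != 0 -> place_unit (rs G).
Proof. by move=> G0; exists G, 1; rewrite !rmorph1 divr1 oner_eq0. Qed.

Lemma place_ideal_poly G : vl G = 0 -> place_ideal (rs G).
Proof. by move=> G0; exists G, 1; rewrite !rmorph1 divr1 oner_eq0. Qed.

Lemma place_unit_ring h : place_unit h -> place_ring h.
Proof. by move=> [G [H [_ H0 hE]]]; exists G, H. Qed.

Lemma place_ringM h k : place_ring h -> place_ring k -> place_ring (h * k).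
Proof.
move=> [G [H [H0 ->]]] [G' [H' [H0' ->]]]; exists (G * G'), (H * H').
by rewrite !(rmorphM rs) !(rmorphM vl) mulf_div mulf_neq0.
Qed.

Lemma place_ringX h n : place_ring h -> place_ring (h ^+ n).
Proof.
move=> hr; elim: n => [|n IH]; last by rewrite exprS; apply: place_ringM.
by exists 1, 1; rewrite !rmorph1 divr1 oner_eq0.
Qed.

Lemma place_unitM h k : place_unit h -> place_unit k -> place_unit (h * k).
Proof.
move=> [G [H [G0 H0 ->]]] [G' [H' [G0' H0' ->]]]; exists (G * G'), (H * H').
by rewrite !(rmorphM rs) !(rmorphM vl) mulf_div !mulf_neq0.
Qed.

Lemma place_idealMr h k : place_ideal h -> place_ring k -> place_ideal (h * k).
Proof.
move=> [G [H [G0 H0 ->]]] [G' [H' [H0' ->]]]; exists (G * G'), (H * H').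
by rewrite !(rmorphM rs) !(rmorphM vl) mulf_div mulf_neq0 // G0 mul0r.
Qed.

Lemma place_ideal_ring h : place_ideal h -> place_ring h.
Proof. by move=> [G [H [_ H0 hE]]]; exists G, H. Qed.

Lemma place_idealX h n : place_ideal h -> place_ideal (h ^+ n.+1).
Proof.
by move=> hi; rewrite exprS; apply/place_idealMr/place_ringX/place_ideal_ring.
Qed.

Lemma place_order_ring h (n : nat) : place_order h n%:Z -> place_ring h.
Proof.
move=> [t [u [[ti _] ur ->]]]; apply: place_ringM; last exact: place_unit_ring.
exact/place_ringX/place_ideal_ring.
Qed.

Lemma place_unit_order0 h t : place_uniformizer t -> place_unit h -> place_order h 0.
Proof. by move=> tu hu; exists t, h; rewrite expr0z mul1r. Qed.

Lemma place_order0_unit h : place_order h 0 -> place_unit h.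
Proof. by move=> [t [u [_ hu ->]]]; rewrite expr0z mul1r. Qed.

Hypothesis rs_vl : forall G, rs G = 0 -> vl G = 0.

Lemma place_denom_neq0 H : vl H != 0 -> rs H != 0.
Proof. by apply: contra_neq; apply: rs_vl. Qed.

(** Cross-multiplying two presentations of one function gives a polynomial that restricts to 0;
    [rs_vl] turns it into an equation between values at the point, of which only one side
    vanishes. *)
Lemma place_ideal_not_unit h : place_ideal h -> ~ place_unit h.
Proof.
move=> [G [H [G0 H0 ->]]] [G' [H' [G0' H0' /eqP]]].
rewrite eqr_div ?place_denom_neq0 // -!rmorphM -subr_eq0 -rmorphB => /eqP/rs_vl/eqP.
by rewrite rmorphB !rmorphM /= G0 mul0r sub0r oppr_eq0 mulf_eq0 (negPf G0') (negPf H0).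
Qed.

End Place.

(** Division by [y - y0], and then of the remainder by [x - x0], leaves the constant [G(x0, y0)]. So
    the maximal ideal of a point has two generators, and a uniformizer need only divide these
    two. *)
Lemma poly2_at_point (K : comNzRingType) (xy : K * K) G : eval_morph idfun xy G = 0 ->
  exists A B, G = ('X - xy.1%:P)%:P * A + ('X - xy.2%:P%:P) * B.
Proof.
pose ev := eval_morph (L := K) idfun xy.
have evC g : ev g%:P = g.[xy.1] by rewrite /ev eval_morphC map_poly_id.
have [B GB] := subr_horner_factor G xy.2%:P.
have [A cA] := subr_horner_factor G.[xy.2%:P] xy.1.
set c := _.[xy.1] in cA.
have {}GB : G = ('X - xy.1%:P)%:P * A%:P + ('X - xy.2%:P%:P) * B + c%:P%:P.
  by rewrite {1}GB cA polyCD polyCM; ring.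
have Y0 : ev ('X - xy.2%:P%:P) = 0 by rewrite rmorphB /= evC hornerC /ev eval_morphX subrr.
have X0 : ev ('X - xy.1%:P)%:P = 0 by rewrite evC !hornerE subrr.
move: (congr1 ev GB); rewrite !(rmorphD ev) !(rmorphM ev) X0 Y0 !mul0r !add0r evC hornerC.
rewrite /ev => -> c0; exists A%:P, B.
by rewrite {1}GB c0 !polyC0 addr0.
Qed.

(** * Affine points of the curve *)

Section CurveLocal.
Context {K : closedFieldType} {L : fieldType} (phi : {rmorphism K -> L}) (x y : L).
Context (e1 e2 e3 : K).

Local Notation f := (cubic e1 e2 e3).

Definition rat_morph : {rmorphism {poly K} -> L} :=
  horner_morph (fun c => mulrC x (phi c) : GRing.comm _ _).
Local Notation rho := rat_morph.

Context (ysq : y ^+ 2 = rho f)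
        (indep : forall r s, rho r + rho s * y = 0 -> r = 0 /\ s = 0).

Local Notation rs := (eval_morph phi (x, y)).
Local Notation vl x0 y0 := (eval_morph (L := K) idfun (x0, y0)).

Lemma rho_eq0 g : (rho g == 0) = (g == 0).
Proof.
apply/eqP/eqP => [g0|->]; last exact: rmorph0.
by have [] := @indep g 0; rewrite // rmorph0 mul0r addr0.
Qed.

Lemma cubic_neq0 : f != 0.
Proof. by rewrite -size_poly_gt0 size_cubic. Qed.

Lemma y_neq0 : y != 0.
Proof. by rewrite -sqrf_eq0 ysq rho_eq0 cubic_neq0. Qed.

Lemma rho_X : rho 'X = x.
Proof. by rewrite /rho /= horner_morphX. Qed.

Lemma rho_C c : rho c%:P = phi c.
Proof. by rewrite /rho /= horner_morphC. Qed.

Lemma x_neq0 : x != 0.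
Proof. by rewrite -rho_X rho_eq0 polyX_eq0. Qed.

Lemma rsC g : rs g%:P = rho g.
Proof. exact: eval_morphC. Qed.

Lemma rsX : rs 'X = y.
Proof. exact: eval_morphX. Qed.

Lemma vlC x0 y0 g : vl x0 y0 g%:P = g.[x0].
Proof. by rewrite eval_morphC map_poly_id. Qed.

Lemma vlX x0 y0 : vl x0 y0 'X = y0.
Proof. exact: eval_morphX. Qed.

Definition affineE := (vlC, vlX, rsC, rsX).

Lemma poly2_reduce (G : {poly {poly K}}) :
  exists Q r s, G = Q * ('X^2 - f%:P) + r%:P + s%:P * 'X.
Proof.
elim/poly_ind: G => [|G g [Q [r [s ->]]]].
  by exists 0, 0, 0; rewrite !polyC0; ring.
exists (Q * 'X + s%:P), (g + s * f), r; rewrite polyCD polyCM; ring.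
Qed.

(** Modulo [y^2 - f] every [G] is some [r + s y]; if it restricts to 0, independence of 1 and [y]
    gives [r = s = 0], so [G] is a multiple of the equation of the curve. This makes values at a
    point well defined on functions. *)
Lemma rs_eq0_vl x0 y0 G : y0 ^+ 2 = f.[x0] -> rs G = 0 -> vl x0 y0 G = 0.
Proof.
move=> c; have [Q [r [s ->]]] := poly2_reduce G.
have rsF : rs ('X^2 - f%:P) = 0 by rewrite (rmorphB rs) (rmorphXn rs) rsX rsC ysq subrr.
have vlF : vl x0 y0 ('X^2 - f%:P) = 0.
  by rewrite (rmorphB (vl _ _)) (rmorphXn (vl _ _)) vlX vlC c subrr.
rewrite !(rmorphD rs) !(rmorphM rs) !(rmorphD (vl _ _)) !(rmorphM (vl _ _)).
rewrite rsF vlF !mulr0 !add0r !affineE => /indep[-> ->].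
by rewrite !horner0 mul0r addr0.
Qed.

Lemma affine_unit x0 y0 r s :
  r.[x0] + s.[x0] * y0 != 0 -> place_unit rs (vl x0 y0) (rho r + rho s * y).
Proof.
move=> rs0; have -> : rho r + rho s * y = rs (r%:P + s%:P * 'X).
  by rewrite (rmorphD rs) (rmorphM rs) !affineE.
by apply: place_unit_poly; rewrite (rmorphD (vl _ _)) (rmorphM (vl _ _)) !affineE.
Qed.

(* Away from the 2-torsion, [y - y0 = (x - x0) g / (y + y0)] on the curve, where
   [g = (f - f(x0)) / (x - x0)]. *)
Lemma uniformizer_x x0 y0 : y0 ^+ 2 = f.[x0] -> y0 + y0 != 0 ->
  place_uniformizer rs (vl x0 y0) (rho ('X - x0%:P)).
Proof.
move=> c y00; split.
  by rewrite -rsC; apply: place_ideal_poly; rewrite vlC !hornerE subrr.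
move=> _ [G [H [/poly2_at_point[A [B ->]] H0 ->]]] /=.
have [g fg] := subr_horner_factor f x0.
have ys0 : y + rho y0%:P != 0.
  apply: contra_neq y00 => y0E.
  have [] := @indep y0%:P 1; first by rewrite rmorph1 mul1r addrC.
  by move=> _ /eqP; rewrite oner_eq0.
exists (rs (A * ('X + y0%:P%:P) + g%:P * B) / rs (H * ('X + y0%:P%:P))).
  exists (A * ('X + y0%:P%:P) + g%:P * B), (H * ('X + y0%:P%:P)); split=> //.
  by rewrite !(rmorphM, rmorphD) /= !affineE hornerC mulf_neq0.
have yy : (y - rho y0%:P) * (y + rho y0%:P) = rho ('X - x0%:P) * rho g.
  rewrite -subr_sqr ysq -rmorphXn -rmorphM -rmorphB /= {1}fg -c; congr (rho _).
  by rewrite polyC_exp; ring.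
rewrite /= !(rmorphD rs) !(rmorphM rs) !(rmorphB rs) ?(rmorphD rs) !affineE.
rewrite invfM !mulrA; apply: (canRL (mulfK ys0)).
rewrite [LHS]mulrAC; congr (_ / _).
transitivity (rho ('X - x0%:P) * (y + rho y0%:P) * rs A
              + ((y - rho y0%:P) * (y + rho y0%:P)) * rs B); first by ring.
by rewrite yy; ring.
Qed.

(** At a ramification point [x - x0 = y^2 / k] with [k] a unit, so both generators of the maximal
    ideal are multiples of [y]. *)
Lemma uniformizer_y x0 k : f = ('X - x0%:P) * k -> k.[x0] != 0 ->
  place_uniformizer rs (vl x0 0) y.
Proof.
move=> fk k0; split.
  by have := @place_ideal_poly _ _ rs (vl x0 0) 'X; rewrite vlX rsX; apply.
move=> _ [G [H [/poly2_at_point[A [B ->]] H0 ->]]] /=.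
have kN : rho k != 0 by rewrite rho_eq0; apply: contraNneq k0 => ->; rewrite horner0.
have yy : rho ('X - x0%:P) * rho k = y * y by rewrite -rmorphM -fk -ysq.
exists (rs (A * 'X + k%:P * B) / rs (H * k%:P)).
  exists (A * 'X + k%:P * B), (H * k%:P); split=> //.
  by rewrite !(rmorphM, rmorphD) /= !affineE mulf_neq0.
rewrite /= !(rmorphD rs) !(rmorphM rs) !(rmorphB rs) ?(rmorphD rs) !affineE (rmorph0 rho) subr0.
rewrite invfM !mulrA; apply: (canRL (mulfK kN)).
rewrite [LHS]mulrAC; congr (_ / _).
transitivity (rho ('X - x0%:P) * rho k * rs A + y * rho k * rs B); first by ring.
by rewrite yy; ring.
Qed.

End CurveLocal.

(** * The point at infinity *)

Section Infinity.
Context {K : closedFieldType} {L : fieldType} (phi : {rmorphism K -> L}) (x y : L).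
Context (e1 e2 e3 : K).

Local Notation f := (cubic e1 e2 e3).
Local Notation rho := (rat_morph phi x).

Context (ysq : y ^+ 2 = rho f)
        (indep : forall r s, rho r + rho s * y = 0 -> r = 0 /\ s = 0).

Local Notation rs := (eval_morph phi (x / y, y^-1)).
Local Notation vl := (eval_morph (L := K) idfun (0, 0)).

Let y0 : y != 0 := y_neq0 ysq indep.
Let x0 : x != 0 := x_neq0 indep.

Lemma infinity_rsC c : rs c%:P%:P = phi c.
Proof. by rewrite eval_morphC map_polyC hornerC. Qed.

Lemma infinity_rs_u : rs 'X%:P = x / y.
Proof. by rewrite eval_morphC map_polyX hornerX. Qed.

Lemma infinity_rs_w : rs 'X = y^-1.
Proof. exact: eval_morphX. Qed.

Lemma infinity_vlC c : vl c%:P%:P = c.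
Proof. by rewrite eval_morphC map_polyC hornerC. Qed.

Lemma infinity_vl_u : vl 'X%:P = 0.
Proof. by rewrite eval_morphC map_polyX hornerX. Qed.

Lemma infinity_vl_w : vl 'X = 0.
Proof. exact: eval_morphX. Qed.

Definition infinityE := (infinity_rsC, infinity_rs_u, infinity_rs_w,
  infinity_vlC, infinity_vl_u, infinity_vl_w).

(* In the chart [u = x / y], [w = 1 / y] at infinity the curve is
   [w = (e1 w - u) (e2 w - u) (e3 w - u)], that is [u^3 = w * infinity_unit]. *)
Definition infinity_unit : {poly {poly K}} :=
  'X%:P ^+ 2 * (e1 + e2 + e3)%:P%:P - 'X%:P * 'X * (e1 * e2 + e1 * e3 + e2 * e3)%:P%:P
  + 'X ^+ 2 * (e1 * e2 * e3)%:P%:P - 1.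

Lemma vl_infinity_unit : vl infinity_unit = -1.
Proof.
rewrite /infinity_unit (rmorphB vl) (rmorph1 vl) (rmorphD vl) (rmorphB vl).
by rewrite !(rmorphM vl) !infinityE !mul0r subr0 addr0 sub0r.
Qed.

Lemma rs_infinity_unit : rs infinity_unit = x ^+ 3 / y ^+ 2.
Proof.
rewrite /infinity_unit (rmorphB rs) (rmorph1 rs) (rmorphD rs) (rmorphB rs).
rewrite !(rmorphM rs) !infinityE.
apply: (canRL (mulfK _)); first by rewrite expf_neq0.
have := ysq; rewrite /cubic !(rmorphM rho) !(rmorphB rho) (rho_X phi x) !(rho_C phi x) => yy.
rewrite mulrBl mul1r {2}yy !(rmorphD, rmorphM) /=.
by field; rewrite ?y0.
Qed.

(** With [u^3 = w * infinity_unit], an element [A u + B w] of the maximal ideal equals [u (A *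
    infinity_unit + u^2 B) / infinity_unit]. *)
Lemma uniformizer_infinity : place_uniformizer rs vl (x / y).
Proof.
split.
  by have := @place_ideal_poly _ _ rs vl 'X%:P; rewrite !infinityE; apply.
move=> _ [G [H [/poly2_at_point[A [B ->]] H0 ->]]].
exists (rs (A * infinity_unit + 'X%:P ^+ 2 * B) / rs (H * infinity_unit)).
  exists (A * infinity_unit + 'X%:P ^+ 2 * B), (H * infinity_unit); split=> //.
  by rewrite (rmorphM vl) vl_infinity_unit mulrN1 oppr_eq0.
rewrite !polyC0 !subr0 !(rmorphD rs) !(rmorphM rs).
rewrite rs_infinity_unit !infinityE.
(* With a zero denominator both sides are 0, as the inverse of 0 is 0. *)
have [->|HN] := eqVneq (rs H) 0; first by rewrite mul0r invr0 !mulr0.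
by field; rewrite x0 y0 HN.
Qed.

End Infinity.

(** [r^2] has even degree and [f s^2] odd degree, so leading terms never cancel. The right side has
    even degree, hence [r^2] dominates: [deg r = m] and [2 deg s + 3 < 2 m]. *)
Lemma pell_sizes (K : closedFieldType) (e1 e2 e3 : K) (m : nat) (r s : {poly K}) :
  r ^+ 2 - cubic e1 e2 e3 * s ^+ 2 = 'X^(m.*2) ->
  (size r = m.+1 /\ size s <= m.-1)%N.
Proof.
move=> rsE; have szX : size ('X^(m.*2) : {poly K}) = m.*2.+1 by rewrite size_polyXn.
have f0 : cubic e1 e2 e3 != 0 by rewrite -size_poly_gt0 size_cubic.
have sq (p : {poly K}) : p != 0 -> size (p ^+ 2) = (size p).*2.-1.
  by move=> p0; rewrite expr2 size_mul // addnn.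
have [s0|sN] := eqVneq s 0.
  move: rsE; rewrite s0 expr0n mulr0 subr0 size_poly0 => rE; split=> //.
  have rN : r != 0 by apply/eqP => r0; move: szX; rewrite -rE r0 expr0n size_poly0.
  by move: szX; rewrite -rE sq //; case: (size r) => //= k [] /double_inj ->.
have sN' := sN; rewrite -size_poly_gt0 in sN'.
have fs : size (cubic e1 e2 e3 * s ^+ 2) = (size s).*2.+2.
  rewrite size_mul ?expf_neq0 // size_cubic sq //.
  by case: (size s) sN' => // k _; rewrite doubleS /= addnC !addnS addn0.
have [r0|rN] := eqVneq r 0.
  move: szX; rewrite -rsE r0 expr0n add0r size_polyN fs => /(congr1 odd).
  by rewrite /= !odd_double.
have rN' := rN; rewrite -size_poly_gt0 in rN'.
have rr := sq _ rN.
have [lt|lt|eq] := ltngtP (size (r ^+ 2)) (size (cubic e1 e2 e3 * s ^+ 2)).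
- move: szX; rewrite -rsE addrC size_polyDl ?size_polyN // fs => /(congr1 odd).
  by rewrite /= !odd_double.
- move: szX; rewrite -rsE size_polyDl ?size_polyN // rr.
  case: (size r) rN' rr => // k _; rewrite doubleS /= => rr [] /double_inj km; subst k.
  by split=> //; move: lt; rewrite fs rr; move: (size s) => j; lia.
- move: (congr1 odd eq); rewrite rr fs /= odd_double.
  by case: (size r) rN' => // k _; rewrite doubleS /= odd_double.
Qed.

Section Orders.
Context {K : closedFieldType} {L : fieldType} (phi : {rmorphism K -> L}) (x y : L).
Context (e1 e2 e3 : K).

Local Notation f := (cubic e1 e2 e3).
Local Notation rho := (rat_morph phi x).

Context (ysq : y ^+ 2 = rho f)
        (indep : forall r s, rho r + rho s * y = 0 -> r = 0 /\ s = 0).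

Local Notation rs := (eval_morph phi (x, y)).
Local Notation vl x0 y0 := (eval_morph (L := K) idfun (x0, y0)).
Local Notation rs' := (eval_morph phi (x / y, y^-1)).
Local Notation vl' := (eval_morph (L := K) idfun (0, 0)).

Let y0 : y != 0 := y_neq0 ysq indep.
Let x0 : x != 0 := x_neq0 indep.

(** Put [t = x / y] and let [z] be the unit [x^3 / y^2]. Then [x = z t^(-2)] and [y = z t^(-3)], so
    [t^(2m) (r + s y)] is a polynomial in [z] and [t]; the degree bounds keep the exponents of [t]
    nonnegative. *)
Lemma order_infinity (m : nat) (r s : {poly K}) : r ^+ 2 - f * s ^+ 2 = 'X^(m.*2) ->
  place_order rs' vl' (rho r + rho s * y) (- (m.*2)%:Z).
Proof.
move=> /pell_sizes[rm sm]; have t0 : x / y != 0 by rewrite mulf_neq0 ?invr_eq0.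
exists (x / y), ((rho r + rho s * y) * (x / y) ^+ m.*2); split; last 1 first.
- by rewrite -exprnN [RHS]mulrC mulfK // expf_neq0.
- exact: uniformizer_infinity ysq indep.
pose A (i : 'I_m.+1) : {poly {poly K}} :=
  (r`_i)%:P%:P * infinity_unit e1 e2 e3 ^+ i * 'X%:P ^+ (m - i).*2.
pose B (i : 'I_m.-1) : {poly {poly K}} :=
  (s`_i)%:P%:P * infinity_unit e1 e2 e3 ^+ i.+1 * 'X%:P ^+ (m.-2 - i).*2.+1.
have [z zE [zy zX]] : exists2 z, rs' (infinity_unit e1 e2 e3) = z &
    z = y * (x / y) ^+ 3 /\ forall i, z ^+ i = x ^+ i * (x / y) ^+ i.*2.
  exists (x ^+ 3 / y ^+ 2); first exact: rs_infinity_unit ysq indep.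
  split=> [|i]; first by field.
  by rewrite -mul2n [(x / y) ^+ _]exprM -exprMn; congr (_ ^+ _); field.
have -> : (rho r + rho s * y) * (x / y) ^+ m.*2 = rs' (\sum_i A i + \sum_i B i).
  rewrite (rmorphD rs') !(rmorph_sum rs') mulrDl; congr (_ + _).
    rewrite -{1}[r]coefK poly_def rm (rmorph_sum rho) mulr_suml; apply: eq_bigr => i _.
    rewrite -mul_polyC (rmorphM rho) (rmorphXn rho) rho_X rho_C.
    rewrite !(rmorphM rs') !(rmorphXn rs') zE !infinityE.
    rewrite zX -!mulrA; congr (_ * _).
    have -> : m.*2 = (i.*2 + (m - i).*2)%N by rewrite -doubleD subnKC // -ltnS ltn_ord.
    by rewrite exprD.
  have -> : s = \poly_(i < m.-1) s`_i.
    by apply/polyP => i; rewrite coef_poly; case: ltnP => // /(leq_trans sm) /(nth_default 0).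
  rewrite poly_def (rmorph_sum rho) !mulr_suml; apply: eq_bigr => i _.
  rewrite -mul_polyC (rmorphM rho) (rmorphXn rho) rho_X rho_C.
  rewrite !(rmorphM rs') !(rmorphXn rs') zE !infinityE.
  rewrite -!mulrA; congr (_ * _).
  have -> : m.*2 = (i.*2 + (m.-2 - i).*2.+4)%N by have := ltn_ord i; lia.
  rewrite exprSr zX {1}zy -[(_ - _).*2.+4]/(3 + (m.-2 - i).*2.+1)%N !exprD -!mulrA.
  by congr (_ * _); rewrite mulrCA.
(* Since [t] vanishes at infinity, only the term [i = m] of the first sum survives, with value
   [r_m (-1)^m]. *)
apply: place_unit_poly; rewrite {}/A {}/B.
have := vl_infinity_unit e1 e2 e3; have := @infinity_vlC K; have := @infinity_vl_u K.
move: vl' => v vu vC vE; rewrite rmorphD !rmorph_sum big_ord_recr /= !big1 => [|i _|i _].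
- rewrite add0r addr0 subnn expr0 mulr1 rmorphM rmorphXn /= vE vC.
  rewrite mulf_neq0 ?expf_neq0 ?oppr_eq0 ?oner_eq0 //.
  by rewrite -[m]/(m.+1.-1) -rm -lead_coefE lead_coef_eq0 -size_poly_gt0 rm.
- by rewrite !rmorphM !rmorphXn /= vu expr0n mulr0.
rewrite !rmorphM !rmorphXn /= vu expr0n double_eq0 subn_eq0 leqNgt.
by rewrite ltn_ord mulr0.
Qed.

End Orders.

(** * Functions with divisor n Q0 - n Qinf *)

Lemma closed_field_sqrt (K : closedFieldType) (c : K) : exists d, d ^+ 2 = c.
Proof.
have [d] := @solve_monicpoly K 2 (fun i => if i is 0 then c else 0) isT.
by rewrite !big_ord_recl big_ord0 /= mul0r expr0 mulr1 !addr0 => dE; exists d.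
Qed.

Lemma closed_field_monomial (K : closedFieldType) (p : {poly K}) : p != 0 ->
  (forall z, z != 0 -> p.[z] != 0) -> exists c n, c != 0 /\ p = c *: 'X^n.
Proof.
move=> p0 pz; have [n [q + pE]] := multiplicity_XsubC p 0; rewrite p0 /= => q0; rewrite subr0 in pE.
have qN : q != 0 by apply: contraNneq q0 => ->; rewrite root0.
have : ~~ (size q != 1)%N.
  apply/negP => /closed_rootP[z qz].
  have [z0|zN] := eqVneq z 0; first by rewrite -z0 qz in q0.
  by move: (pz z zN); rewrite pE hornerM (rootP qz) mul0r eqxx.
rewrite negbK => /size_poly1P[c cN qE]; exists c, n; split=> //.
by rewrite pE qE mul_polyC.
Qed.

Lemma cubic_simple_root (K : fieldType) (e1 e2 e3 x0 : K) :
  uniq [:: e1; e2; e3] -> (cubic e1 e2 e3).[x0] = 0 ->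
  exists2 k, cubic e1 e2 e3 = ('X - x0%:P) * k & k.[x0] != 0.
Proof.
rewrite /= !inE negb_or andbT => /andP[/andP[e12 e13] e23] /eqP.
rewrite /cubic !hornerE !mulf_eq0 !subr_eq0 => /orP[/orP[]|] /eqP <-.
- exists (- ((e2%:P - 'X) * (e3%:P - 'X))); first by ring.
  by rewrite !hornerE oppr_eq0 mulf_neq0 // subr_eq0 eq_sym.
- exists (- ((e1%:P - 'X) * (e3%:P - 'X))); first by ring.
  by rewrite !hornerE oppr_eq0 mulf_neq0 // subr_eq0 // eq_sym.
- exists (- ((e1%:P - 'X) * (e2%:P - 'X))); first by ring.
  by rewrite !hornerE oppr_eq0 mulf_neq0 // subr_eq0.
Qed.

Section Pell.
Context {K : closedFieldType} {L : fieldType} (phi : {rmorphism K -> L}) (x y : L).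
Context (e1 e2 e3 : K) (two : (2 : K) != 0) (euniq : uniq [:: e1; e2; e3]).

Local Notation f := (cubic e1 e2 e3).
Local Notation rho := (rat_morph phi x).

Context (ysq : y ^+ 2 = rho f)
        (indep : forall r s, rho r + rho s * y = 0 -> r = 0 /\ s = 0).

Local Notation rs := (eval_morph phi (x, y)).
Local Notation vl x0 y0 := (eval_morph (L := K) idfun (x0, y0)).

Let yN : y != 0 := y_neq0 ysq indep.

Lemma double_neq0 (c : K) : c != 0 -> c + c != 0.
Proof. by move=> c0; rewrite -mulr2n -mulr_natl mulf_neq0. Qed.

Lemma uniformizer_exists x0 y0 : y0 ^+ 2 = f.[x0] ->
  exists t, place_uniformizer rs (vl x0 y0) t.
Proof.
move=> c; have [y00|y0N] := eqVneq y0 0; last first.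
  by exists (rho ('X - x0%:P)); apply: (uniformizer_x ysq indep) => //; apply: double_neq0.
have [k fk k0] : exists2 k, f = ('X - x0%:P) * k & k.[x0] != 0.
  by apply: cubic_simple_root => //; rewrite -c y00 expr0n.
by exists y; rewrite y00; apply: (uniformizer_y ysq indep) fk k0.
Qed.

Lemma order_affine_unit x0 y0 (r s : {poly K}) : y0 ^+ 2 = f.[x0] -> r.[x0] + s.[x0] * y0 != 0 ->
  place_order rs (vl x0 y0) (rho r + rho s * y) 0.
Proof.
move=> c rs0; have [t ut] := uniformizer_exists c.
by apply: place_unit_order0 ut _; apply: affine_unit.
Qed.

(** The product of [r + s y] with its conjugate [r - s y] is [x^n], and the conjugate is a unit at
    [(0, q)]. *)
Lemma order_at_zero (q : K) (n : nat) (r s : {poly K}) : q ^+ 2 = f.[0] -> q != 0 ->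
  r ^+ 2 - f * s ^+ 2 = 'X^n -> r.[0] - s.[0] * q != 0 ->
  place_order rs (vl 0 q) (rho r + rho s * y) n.
Proof.
move=> c q0 pell rs0.
have rsN : rs (r%:P - s%:P * 'X) != 0.
  apply: (place_denom_neq0 (vl := vl 0 q)).
    by move=> G; apply: (rs_eq0_vl ysq indep).
  by rewrite (rmorphB (vl 0 q)) (rmorphM (vl 0 q)) !affineE.
exists (rho 'X), (rs (r%:P - s%:P * 'X))^-1; split.
- by rewrite -['X]subr0 -polyC0; apply: (uniformizer_x ysq indep) => //; apply: double_neq0.
- exists 1, (r%:P - s%:P * 'X); rewrite !rmorph1 div1r oner_eq0; split=> //.
  by rewrite (rmorphB (vl 0 q)) (rmorphM (vl 0 q)) !affineE.
apply: (canRL (mulfK rsN)); rewrite (rmorphB rs) (rmorphM rs) !affineE.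
transitivity (rho r ^+ 2 - y ^+ 2 * rho s ^+ 2); first by ring.
by rewrite ysq -exprnP -[RHS](rmorphXn rho) -pell (rmorphB rho) (rmorphM rho f) !(rmorphXn rho).
Qed.

Context (gen : forall h, exists d u v, d != 0 /\ rho d * h = rho u + rho v * y).

(* A zero of a common denominator of [h] is a zero of both coefficients of the
   numerator, by evaluation at the two points of the curve above it; at a
   ramification point ['X - x0] is replaced by [y^2] and one [y] is cancelled. *)
Lemma regular_poly h :
  (forall x0 y0, y0 ^+ 2 = f.[x0] -> place_ring rs (vl x0 y0) h) ->
  exists r s, h = rho r + rho s * y.
Proof.
move=> reg; have [d [u [v [dN hE]]]] := gen h.
elim: {d}(size d) {-2}d (leqnn (size d)) u v dN hE => [|n IH] d dn u v dN hE.
  by move: dn; rewrite leqn0 size_poly_eq0 (negPf dN).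
have [/size_poly1P[c c0 dE]|/closed_rootP[x0 /factor_theorem[d1 dE]]] := boolP (size d == 1)%N.
  exists (c^-1 *: u), (c^-1 *: v); have c0' : phi c != 0 by rewrite fmorph_eq0.
  apply: (mulfI c0'); rewrite -{1}(rho_C phi x) -dE hE mulrDr mulrA -(rho_C phi x).
  by rewrite -!rmorphM !mul_polyC !scalerA divff // !scale1r.
have [y0 c] := closed_field_sqrt f.[x0].
have key y1 : y1 ^+ 2 = f.[x0] -> exists G H, [/\ vl x0 y1 H != 0, rs H != 0,
    rs H * (rho u + rho v * y) = rho d * rs G & u.[x0] + v.[x0] * y1 = 0].
  move=> c1; have [G [H [H0 hGH]]] := reg _ _ c1; exists G, H.
  have HN : rs H != 0.
    by apply: contra_neq H0 => /(rs_eq0_vl ysq indep c1).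
  have E : rs H * (rho u + rho v * y) = rho d * rs G.
    by rewrite -hE hGH mulrCA [rs H * _]mulrC divfK.
  split=> //; apply: (mulfI H0); rewrite mulr0.
  have : rs (H * (u%:P + v%:P * 'X) - d%:P * G) = 0.
    by rewrite (rmorphB rs) !(rmorphM rs) (rmorphD rs) (rmorphM rs) !affineE E subrr.
  move/(rs_eq0_vl ysq indep c1).
  rewrite (rmorphB (vl _ _)) !(rmorphM (vl _ _)) (rmorphD (vl _ _)) (rmorphM (vl _ _)).
  by rewrite !affineE dE !hornerE subrr mulr0 mul0r subr0.
have uv0 : u.[x0] = 0 /\ v.[x0] = 0.
  have [G [H [H0 HN E uv]]] := key _ c.
  have [y00|y0N] := eqVneq y0 0; last first.
    have [_ [_ [_ _ _ uv']]] := key (- y0) (etrans (sqrrN _) c).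
    have u0 : u.[x0] = 0.
      apply/eqP; apply: contraT => /double_neq0/eqP[].
      have -> : u.[x0] + u.[x0] = (u.[x0] + v.[x0] * y0) + (u.[x0] + v.[x0] * - y0) by ring.
      by rewrite uv uv' addr0.
    split=> //; apply/eqP; move/eqP: uv.
    by rewrite u0 add0r mulf_eq0 (negPf y0N) orbF.
  have u0 : u.[x0] = 0 by rewrite -uv y00 mulr0 addr0.
  split=> //; have [k fk k0] : exists2 k, f = ('X - x0%:P) * k & k.[x0] != 0.
    by apply: cubic_simple_root => //; rewrite -c y00 expr0n.
  have /factor_theorem[u1 uE] : root u x0 by apply/eqP.
  have E' : rs H * (rho u1 * y + rho k * rho v) = rho d1 * y * rs G.
    apply: (mulIf yN).
    have yy : y * y = rho ('X - x0%:P) * rho k by rewrite -rmorphM -fk -ysq.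
    have := congr1 ( *%R (rho k)) E; rewrite uE dE (rmorphM rho u1) (rmorphM rho d1) => EE.
    transitivity (rs H * (rho u1 * (y * y) + rho k * rho v * y)); first by ring.
    transitivity (rho d1 * (y * y) * rs G); last by ring.
    rewrite yy; transitivity (rho k * (rho d1 * rho ('X - x0%:P) * rs G)); last by ring.
    by rewrite -EE; ring.
  have c0 : 0 ^+ 2 = f.[x0] by rewrite -c y00.
  have : rs (H * (u1%:P * 'X + k%:P * v%:P) - d1%:P * 'X * G) = 0.
    rewrite (rmorphB rs) !(rmorphM rs) (rmorphD rs) !(rmorphM rs) !affineE.
    by rewrite E' subrr.
  move/(rs_eq0_vl ysq indep c0).
  rewrite (rmorphB (vl _ _)) !(rmorphM (vl _ _)) (rmorphD (vl _ _)) !(rmorphM (vl _ _)).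
  rewrite !affineE !mulr0 mul0r subr0 add0r => /eqP.
  rewrite y00 in H0; by rewrite !mulf_eq0 (negPf H0) (negPf k0) => /eqP.
have [/factor_theorem[u1 uE] /factor_theorem[v1 vE]] : root u x0 /\ root v x0.
  by split; apply/eqP; case: uv0.
have XN : 'X - x0%:P != 0 :> {poly K} by rewrite polyXsubC_eq0.
have d1N : d1 != 0 by apply: contraNneq dN => d10; rewrite dE d10 mul0r.
apply: (IH d1 _ u1 v1 d1N).
  by move: dn; rewrite dE size_mul // size_XsubC addn2 ltnS.
apply: (mulIf (_ : rho ('X - x0%:P) != 0)); first by rewrite (rho_eq0 indep).
rewrite mulrAC -rmorphM -dE hE uE vE !rmorphM /=; ring.
Qed.

(** Regularity at all affine points gives [h = r + s y]. Its norm [r^2 - f s^2] has no zero off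
    [x = 0], so it is a monomial; the order at [(0, q)] gives the exponent, and a square root of the
    coefficient is scaled away. *)
Lemma pell_of_order (q : K) (n : nat) h : q ^+ 2 = f.[0] -> q != 0 -> h != 0 ->
  (forall x0 y0, y0 ^+ 2 = f.[x0] -> (x0, y0) != (0, q) ->
     place_order rs (vl x0 y0) h 0) ->
  place_order rs (vl 0 q) h n ->
  exists r s, r ^+ 2 - f * s ^+ 2 = 'X^n /\ r.[0] - s.[0] * q != 0.
Proof.
move=> c qN hN ord0 ordn.
have nv x0 y0 : y0 ^+ 2 = f.[x0] -> forall G, rs G = 0 -> vl x0 y0 G = 0.
  by move=> c0 G; apply: (rs_eq0_vl ysq indep c0).
have [r [s hE]] : exists r s, h = rho r + rho s * y.
  apply: regular_poly => x0 y0 c0.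
  have [[-> ->]|ne] := eqVneq (x0, y0) (0, q); first exact: place_order_ring ordn.
  by apply: (@place_order_ring _ _ _ _ _ 0); apply: ord0.
have valN x0 y0 : y0 ^+ 2 = f.[x0] -> (x0, y0) != (0, q) -> r.[x0] + s.[x0] * y0 != 0.
  move=> c0 ne; have [G [H [G0 H0 hGH]]] := place_order0_unit (ord0 _ _ c0 ne).
  have HN := place_denom_neq0 (nv _ _ c0) H0.
  have : rs (H * (r%:P + s%:P * 'X) - G) = 0.
    rewrite (rmorphB rs) (rmorphM rs) (rmorphD rs) (rmorphM rs) !affineE.
    by rewrite -hE hGH mulrC divfK // subrr.
  move/(nv _ _ c0).
  rewrite (rmorphB (vl _ _)) (rmorphM (vl _ _)) (rmorphD (vl _ _)) (rmorphM (vl _ _)).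
  rewrite !affineE => /subr0_eq; apply: contra_eq_neq => ->.
  by rewrite mulr0 eq_sym.
(* This is the value of [h] at the conjugate point [(0, -q)], where its order is 0. *)
have rs0 : r.[0] - s.[0] * q != 0.
  rewrite -mulrN; apply: valN; first by rewrite sqrrN.
  by rewrite xpair_eqE eqxx /= -subr_eq0 -opprD oppr_eq0 double_neq0.
have [b [N [b0 pellN]]] : exists b N, b != 0 /\ r ^+ 2 - f * s ^+ 2 = b *: 'X^N.
  have nz z : z != 0 -> (r ^+ 2 - f * s ^+ 2).[z] != 0.
    move=> z0; have [w wE] := closed_field_sqrt f.[z].
    have -> : (r ^+ 2 - f * s ^+ 2).[z] = (r.[z] + s.[z] * w) * (r.[z] + s.[z] * - w).
      by rewrite hornerD hornerN !horner_exp hornerM horner_exp -wE; ring.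
    by rewrite mulf_neq0 ?valN ?sqrrN // xpair_eqE (negPf z0).
  apply: closed_field_monomial (nz); apply/eqP => N0.
  by have := nz 1 (oner_neq0 _); rewrite N0 horner0 eqxx.
suff NE : N = n.
  have [d dE] := closed_field_sqrt b; rewrite {}NE in pellN.
  have dN : d != 0 by apply: contraNneq b0 => d0; rewrite -dE d0 expr0n.
  exists (d^-1 *: r), (d^-1 *: s); split; last first.
    by rewrite !hornerZ -mulrA -mulrBr mulf_neq0 // invr_eq0.
  by rewrite !exprZn -scalerAr -scalerBr pellN scalerA exprVn dE mulVf // scale1r.
have {}nv := nv _ _ c; have [t [u [[ti tu] uu hu]]] := ordn.
have : place_uniformizer rs (vl 0 q) (rho 'X).
  by rewrite -['X]subr0 -polyC0; apply: (uniformizer_x ysq indep) => //; apply: double_neq0.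
rewrite rho_X => xi.
have [g gr xt] := tu _ xi.1; have [g' gr' tx] := xi.2 _ ti.
pose hb := rho r + rho (- s) * y.
have hbu : place_unit rs (vl 0 q) hb by apply: affine_unit; rewrite hornerN mulNr.
have norm : t ^+ n * (u * hb) = phi b * x ^+ N.
  have -> : t ^+ n * (u * hb) = h * hb by rewrite hu mulrA.
  rewrite hE /hb (rmorphN rho).
  transitivity (rho r ^+ 2 - y ^+ 2 * rho s ^+ 2); first by ring.
  rewrite ysq -!(rmorphXn rho) -rmorphM -rmorphB /= pellN -mul_polyC rmorphM rmorphXn /=.
  by rewrite rho_C rho_X.
have bu : place_unit rs (vl 0 q) (phi b).
  exists b%:P%:P, 1; rewrite !rmorph1 divr1 oner_eq0 affineE hornerC b0; split=> //.
  by rewrite affineE rho_C.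
have xN := x_neq0 indep.
(* [norm] equates [t^n] times a unit with [b x^N], and [t] and [x] divide each other locally. If
   [N < n] the unit [phi b], if [N > n] the unit [u * hb], would lie in the maximal ideal. *)
have [lt|lt|//] := ltngtP N n; exfalso.
  apply: (place_ideal_not_unit nv _ bu).
  suff -> : phi b = x ^+ (n - N).-1.+1 * (g' ^+ n * (u * hb)).
    apply: place_idealMr; first exact: place_idealX xi.1.
    by apply: place_ringM; [apply: place_ringX|apply/place_unit_ring/place_unitM].
  rewrite prednK ?subn_gt0 //; apply: (mulIf (expf_neq0 N xN)).
  rewrite -norm tx exprMn -{1}(subnK (ltnW lt)) exprD; ring.
apply: (place_ideal_not_unit nv _ (place_unitM uu hbu)).
have tN : t ^+ n != 0.
  by apply: contraNneq hN => tn0; rewrite hu -exprnP tn0 mul0r.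
suff -> : u * hb = t ^+ (N - n).-1.+1 * (g ^+ N * phi b).
  apply: place_idealMr; first exact: place_idealX ti.
  by apply: place_ringM; [apply: place_ringX|apply: place_unit_ring].
rewrite prednK ?subn_gt0 //; apply: (mulfI tN).
rewrite norm xt exprMn -{1}(subnK (ltnW lt)) exprD; ring.
Qed.

End Pell.

Lemma fraction_quotient (A : idomainType) (r : {fraction A}) :
  exists u v : A, v != 0 /\ tofrac v * r = tofrac u.
Proof.
pose x : {ratio A} := repr (r : FracField.type A).
have rx : r = \pi_(FracField.type A)%qT x by rewrite reprK.
exists (frac x).1, (frac x).2; split; first exact: denom_ratioP.
rewrite mulrC rx; unlock FracField.tofrac; rewrite -[LHS]FracField.pi_mul.
apply/eqmodP; rewrite /= FracField.equivfE /FracField.mulf.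
rewrite !numden_Ratio ?mulf_neq0 ?oner_eq0 ?denom_ratioP //.
by rewrite !mulr1 mulrC.
Qed.

(** * The function field of the curve *)

Section LinearRepresentatives.
Context {F : fieldType} (h : {poly F}) (hm : h \is monic) (hs : size h = 3).

Lemma mk_monic_id : mk_monic h = h.
Proof. by rewrite /mk_monic hm hs. Qed.

Lemma in_qpoly_linear_eq0 (c d : F) :
  in_qpoly h (c%:P + d%:P * 'X) = 0 -> c = 0 /\ d = 0.
Proof.
have ps : (size (c%:P + d%:P * 'X)%R < size (mk_monic h))%N.
  rewrite mk_monic_id hs ltnS (leq_trans (size_polyD _ _)) //.
  rewrite geq_max (leq_trans (size_polyC_leq1 _)) //=.
  by rewrite (leq_trans (size_polyMleq _ _)) // size_polyX addn2 /= ltnS size_polyC_leq1.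
move/(congr1 (fun q : {poly %/ h} => q : {poly _})); rewrite in_qpoly_small // => p0.
have pE i : (c%:P + d%:P * 'X)`_i = 0 by rewrite p0; apply: coef0.
by have := pE 0; have := pE 1; rewrite !coefD !coefMX !coefC add0r addr0.
Qed.

Lemma in_qpoly_linear_gen (q : {poly %/ h}) :
  exists c d : F, q = in_qpoly h (c%:P + d%:P * 'X).
Proof.
exists q`_0, q`_1.
have qs : (size q <= 2)%N by rewrite -ltnS (leq_trans (size_mk_monic q)) // mk_monic_id hs.
have -> : (q`_0)%:P + (q`_1)%:P * 'X = q.
  apply/polyP => i; rewrite coefD coefMX !coefC.
  case: i => [|[|i]] /=; rewrite ?addr0 ?add0r // nth_default //.
  exact: leq_trans qs _.
by apply/val_inj; rewrite /= Pdiv.CommonRing.rmodp_small // size_mk_monic.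
Qed.

End LinearRepresentatives.

Section CurveFunctions.
Context {K : closedFieldType} (e1 e2 e3 : K).

Local Notation FF := (function_field e1 e2 e3).
Local Notation f := (cubic e1 e2 e3).
Local Notation cp := (curve_poly e1 e2 e3).
Local Notation iq := (in_qpoly cp).

Lemma ff_rat_zmod_morphism : zmod_morphism (ff_rat e1 e2 e3).
Proof. by move=> x y; rewrite /ff_rat polyCB; apply: (raddfB iq). Qed.

Lemma ff_rat_monoid_morphism : monoid_morphism (ff_rat e1 e2 e3).
Proof.
split=> [|x y]; rewrite /ff_rat; first by rewrite polyC1; apply: (rmorph1 iq).
by rewrite polyCM; apply: (rmorphM iq).
Qed.

HB.instance Definition _ :=
  GRing.isZmodMorphism.Build _ FF (ff_rat e1 e2 e3) ff_rat_zmod_morphism.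
HB.instance Definition _ :=
  GRing.isMonoidMorphism.Build _ FF (ff_rat e1 e2 e3) ff_rat_monoid_morphism.

Definition ff_poly (g : {poly K}) : FF := ff_rat e1 e2 e3 (tofrac g).

Lemma ff_poly_zmod_morphism : zmod_morphism ff_poly.
Proof. exact: raddfB (ff_rat e1 e2 e3 \o @tofrac {poly K}). Qed.

Lemma ff_poly_monoid_morphism : monoid_morphism ff_poly.
Proof.
split; first exact: rmorph1 (ff_rat e1 e2 e3 \o @tofrac {poly K}).
exact: rmorphM (ff_rat e1 e2 e3 \o @tofrac {poly K}).
Qed.

HB.instance Definition _ := GRing.isZmodMorphism.Build _ FF ff_poly ff_poly_zmod_morphism.
HB.instance Definition _ := GRing.isMonoidMorphism.Build _ FF ff_poly ff_poly_monoid_morphism.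

Lemma ff_polyM g k : ff_poly (g * k) = ff_poly g * ff_poly k.
Proof. exact: (rmorphM ff_poly). Qed.

HB.instance Definition _ := GRing.RMorphism.copy (ff_const e1 e2 e3) (ff_poly \o polyC).

Lemma eval_ff_x (g : {poly K}) :
  (map_poly (ff_const e1 e2 e3) g).[ff_x e1 e2 e3] = ff_poly g.
Proof.
rewrite -[g in RHS]coefK poly_def rmorph_sum horner_coef size_map_poly.
by apply: eq_bigr => i _; rewrite coef_map -mul_polyC rmorphM rmorphXn.
Qed.

Lemma size_curve_poly : size cp = 3.
Proof.
rewrite /curve_poly size_polyDl ?size_polyXn // size_polyN.
by apply: leq_ltn_trans (size_polyC_leq1 _) _.
Qed.

Lemma curve_poly_monic : cp \is monic.
Proof. by case: (curve_poly_monic_irreducible e1 e2 e3). Qed.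

Lemma ff_y_sqr : ff_y e1 e2 e3 ^+ 2 = ff_poly f.
Proof.
have cp0 : iq cp = 0.
  apply/val_inj; rewrite /= (mk_monic_id curve_poly_monic size_curve_poly).
  by rewrite (Pdiv.RingMonic.rmodpp curve_poly_monic).
suff : iq 'X ^+ 2 - iq (tofrac f)%:P = 0 by move/subr0_eq.
by rewrite -(rmorphXn iq) -(rmorphB iq).
Qed.

Lemma ff_poly_indep (r s : {poly K}) :
  ff_poly r + ff_poly s * ff_y e1 e2 e3 = 0 -> r = 0 /\ s = 0.
Proof.
move=> rs0; have : iq ((tofrac r)%:P + (tofrac s)%:P * 'X) = 0.
  by rewrite (rmorphD iq) (rmorphM iq).
case/(in_qpoly_linear_eq0 curve_poly_monic size_curve_poly) => /eqP + /eqP.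
by rewrite !tofrac_eq0 => /eqP -> /eqP ->.
Qed.

Lemma ff_poly_frac u v (c : {fraction {poly K}}) : tofrac v * c = tofrac u ->
  ff_poly v * ff_rat e1 e2 e3 c = ff_poly u.
Proof.
move=> E; have H := rmorphM (ff_rat e1 e2 e3) (tofrac v) c.
by rewrite /ff_poly -H E.
Qed.

Lemma ff_poly_gen (h : FF) : exists d u v : {poly K},
  d != 0 /\ ff_poly d * h = ff_poly u + ff_poly v * ff_y e1 e2 e3.
Proof.
have [c0 [c1 hE]] : exists c0 c1, h = ff_rat e1 e2 e3 c0 + ff_rat e1 e2 e3 c1 * ff_y e1 e2 e3.
  have [c0 [c1 ->]] := in_qpoly_linear_gen curve_poly_monic size_curve_poly h.
  by exists c0, c1; rewrite (rmorphD iq) (rmorphM iq).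
have [u0 [v0 [v0N E0]]] := fraction_quotient c0.
have [u1 [v1 [v1N E1]]] := fraction_quotient c1.
have F0 := ff_poly_frac E0; have F1 := ff_poly_frac E1.
exists (v0 * v1), (u0 * v1), (u1 * v0); split; first by rewrite mulf_neq0.
rewrite hE !ff_polyM -F0 -F1.
have E (L : comNzRingType) (z0 z1 w0 w1 t : L) :
  z0 * z1 * (w0 + w1 * t) = z0 * w0 * z1 + z1 * w1 * z0 * t by ring.
exact: E.
Qed.

End CurveFunctions.

Lemma coeff_mulrn_diff (T : choiceType) (P Q O : T) (n : nat) :
  coeff P (<< Q >> *+ n - << O >> *+ n : {freeg T / int})
  = n%:Z * (Q == P)%:R - n%:Z * (O == P)%:R.
Proof.
by rewrite coeffB !coeffMn !coeffU !mul1r; case: (Q == P); case: (O == P);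
  rewrite ?mulr1n ?mulr0n ?mul0rn ?mulr1 ?mulr0 ?natz.
Qed.

Section FunctionField.
Context {K : closedFieldType} (e1 e2 e3 : K) (two : (2 : K) != 0).
Context (euniq : uniq [:: e1; e2; e3]).

Local Notation f := (cubic e1 e2 e3).
Local Notation FF := (function_field e1 e2 e3).
Local Notation phi := (ff_const e1 e2 e3 : {rmorphism K -> FF}).
Local Notation x := (ff_x e1 e2 e3).
Local Notation y := (ff_y e1 e2 e3).
Local Notation rho := (rat_morph (L := FF) phi x).
Local Notation point := (curve_point e1 e2 e3).

Lemma rat_morph_ff g : rho g = ff_poly e1 e2 e3 g.
Proof. exact: eval_ff_x. Qed.

Lemma restrict_at_eval (P : point) :
  restrict_at P = eval_morph (L := FF) phi (chart_functions P).
Proof. by apply/boolp.funext => G; rewrite eval_morphE. Qed.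

Lemma value_at_eval (P : point) :
  value_at P = eval_morph (L := K) idfun (chart_coords P).
Proof. by apply/boolp.funext => G; rewrite eval_morphE. Qed.

Lemma has_order_place (P : point) h m :
  has_order P h m = place_order (restrict_at P) (value_at P) h m.
Proof. reflexivity. Qed.

Lemma has_order_affine x0 y0 c h m :
  has_order (exist (on_curve e1 e2 e3) (Some (x0, y0)) c : point) h m =
  place_order (L := FF) (eval_morph phi (x, y)) (eval_morph (L := K) idfun (x0, y0)) h m.
Proof. by rewrite has_order_place restrict_at_eval value_at_eval. Qed.

Lemma has_order_infinity h m :
  has_order (point_infinity e1 e2 e3) h m =
  place_order (L := FF) (eval_morph phi (x / y, y^-1)) (eval_morph (L := K) idfun (0, 0)) h m.
Proof. by rewrite has_order_place restrict_at_eval value_at_eval. Qed.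

Let ysq : y ^+ 2 = rho f.
Proof. by rewrite ff_y_sqr rat_morph_ff. Qed.

Let indep r s : rho r + rho s * y = 0 -> r = 0 /\ s = 0.
Proof. by rewrite !rat_morph_ff; apply: ff_poly_indep. Qed.

Let gen h : exists d u v, d != 0 /\ rho d * h = rho u + rho v * y.
Proof.
have [d [u [v [d0 E]]]] := ff_poly_gen h; exists d, u, v.
by rewrite !rat_morph_ff.
Qed.

(** The condition at 0 distinguishes [(0, q)] from its conjugate: it keeps [r - s y] from vanishing
    at [(0, q)], so the whole zero of the norm [x^(2m)] there belongs to [r + s y]. The order at
    infinity follows from the degrees. *)
Lemma lin_equiv_pellP (q : K) (c : on_curve e1 e2 e3 (Some (0, q))) (m : nat) :
    q != 0 -> (0 < m)%N ->
  lin_equiv (<< exist (on_curve e1 e2 e3) (Some (0, q)) c : point >> *+ m.*2)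
            (<< point_infinity e1 e2 e3 >> *+ m.*2) <->
  exists r s, r ^+ 2 - f * s ^+ 2 = 'X^(m.*2) /\ r.[0] - s.[0] * q != 0.
Proof.
move=> qN m0.
have fE z : f.[z] = (e1 - z) * (e2 - z) * (e3 - z) by rewrite /cubic !hornerE.
have onE x0 y0 : on_curve e1 e2 e3 (Some (x0, y0)) -> y0 ^+ 2 = f.[x0].
  by move=> /eqP ->; rewrite fE.
have offE x0 y0 : y0 ^+ 2 = f.[x0] -> on_curve e1 e2 e3 (Some (x0, y0)).
  by rewrite fE => /eqP.
have cf := onE _ _ c.
pose Q : point := exist (on_curve e1 e2 e3) (Some (0, q)) c.
have coA x0 y0 c0 : coeff (exist (on_curve e1 e2 e3) (Some (x0, y0)) c0 : point)
    (<< Q >> *+ m.*2 - << point_infinity e1 e2 e3 >> *+ m.*2 : divisor e1 e2 e3)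
    = (m.*2)%:Z * ((0, q) == (x0, y0))%:R.
  by rewrite coeff_mulrn_diff -!val_eqE /= mulr0 subr0.
split.
- move=> [h h0 hD].
  apply: (pell_of_order two euniq ysq indep gen (h := h)) => //.
  + move=> x0 y0 c0 ne; have := hD (exist (on_curve e1 e2 e3) (Some (x0, y0)) (offE _ _ c0)).
    by rewrite coA eq_sym (negPf ne) mulr0 has_order_affine.
  + by have := hD Q; rewrite coA eqxx mulr1 has_order_affine.
move=> [r [s [pell rs0]]]; exists (rho r + rho s * y).
  apply/eqP => /indep[r0 s0]; move: pell; rewrite r0 s0 expr0n mulr0 subr0 /=.
  by move/esym/eqP; rewrite expf_eq0 polyX_eq0 andbF.
move=> P; case: P => [[[x0 y0]|] c0]; last first.
  have -> : exist (on_curve e1 e2 e3) None c0 = point_infinity e1 e2 e3 by apply: val_inj.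
  rewrite has_order_infinity coeff_mulrn_diff eqxx mulr1 -val_eqE /= mulr0 sub0r.
  exact: (order_infinity ysq indep pell).
rewrite coA has_order_affine; have c0' := onE _ _ c0.
have [[<- <-]|ne] := eqVneq (0, q) (x0, y0).
  by rewrite mulr1; apply: (order_at_zero two ysq indep).
rewrite mulr0; apply: (order_affine_unit two euniq ysq indep c0').
(* Off [x = 0] the norm [x0^(2m)] is nonzero; over [x = 0] the only other point is [(0, -q)], with
   value [r(0) - s(0) q]. *)
have [x00|xN] := eqVneq x0 0; last first.
  apply: contraNneq (expf_neq0 m.*2 xN) => rsy.
  rewrite -(hornerXn x0 m.*2) -pell hornerD hornerN !horner_exp hornerM horner_exp -c0'.
  rewrite (_ : _ - _ = (r.[x0] + s.[x0] * y0) * (r.[x0] - s.[x0] * y0)); last by ring.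
  by rewrite rsy mul0r.
rewrite x00 in c0' ne *; have : (y0 - q) * (y0 + q) == 0.
  by rewrite -subr_sqr c0' cf subrr.
rewrite mulf_eq0 subr_eq0 addr_eq0 => /orP[/eqP y0q|/eqP ->]; last by rewrite mulrN.
by rewrite y0q eqxx in ne.
Qed.

End FunctionField.

(** * Lax matrices of the billiard *)

(** The four entries of the conjugation in [step_lax]. The first and third hypotheses are the
    reflection laws of [U] and [V] after a flight; the second is the flight law of [W], which
    depends on the position alone. *)
Lemma step_lax_ring (R : comPzRingType) (X s t U U1 V V1 W W1 : R) :
  X * U1 = X * (U + s * V) + t * W1 -> W1 = W - 2 * s * U - s ^+ 2 * V ->
  X * V1 = X * V - t * ((U + s * V) + U1) ->
  [/\ (X - t * s) * U + t * W = U1 * (X - t * s) + V1 * - (s * X),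
      (X - t * s) * V + t * - U = U1 * t + V1 * X,
      - (s * X) * U + X * W = W1 * (X - t * s) + - U1 * - (s * X)
    & - (s * X) * V + X * - U = W1 * t + - U1 * X].
Proof.
move=> E1 E2 E3; have D1 : X * U1 - (X * (U + s * V) + t * W1) = 0 by rewrite E1 subrr.
have D3 : X * V1 - (X * V - t * ((U + s * V) + U1)) = 0 by rewrite E3 subrr.
rewrite {}E2 {E1 E3} in D1 *.
split; apply: subr0_eq; [rewrite -[0](subr0) -{1}(mulr0 s) -{1}D3 -D1
  |rewrite -oppr0 -D3|rewrite -(mulr0 (- s)) -D1|rewrite -D1]; ring.
Qed.

Section Lax.
Context {F : fieldType} (a b : F).

Section Matrix.
Context (x1 x2 v1 v2 : F).

Definition lax_u : {poly F} :=
  (x1 * v1)%:P * (b%:P - 'X) + (x2 * v2)%:P * (a%:P - 'X).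
Definition lax_v : {poly F} :=
  (v1 ^+ 2)%:P * (b%:P - 'X) + (v2 ^+ 2)%:P * (a%:P - 'X).
Definition lax_w : {poly F} :=
  (a%:P - 'X) * (b%:P - 'X) - (x1 ^+ 2)%:P * (b%:P - 'X) - (x2 ^+ 2)%:P * (a%:P - 'X).

(** [U^2 + V W = (a - l) (b - l) (V - J^2)] with [J = x1 v2 - x2 v1]; tangency and unit speed reduce
    the last factor to [beta - l]. *)
Lemma lax_curve beta : v1 ^+ 2 + v2 ^+ 2 = 1 ->
  (x1 * v2 - x2 * v1) ^+ 2 = v1 ^+ 2 * (b - beta) + v2 ^+ 2 * (a - beta) ->
  lax_u ^+ 2 + lax_v * lax_w = cubic a b beta.
Proof.
move=> vv ell; apply/eqP; rewrite -subr_eq0; apply/eqP.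
transitivity ((a%:P - 'X) * (b%:P - 'X) *
  (lax_v - (beta%:P - 'X) - ((x1 * v2 - x2 * v1) ^+ 2)%:P)).
  by rewrite /lax_u /lax_v /lax_w /cubic; ring.
rewrite ell.
transitivity ((a%:P - 'X) * (b%:P - 'X) *
  ((v1 ^+ 2 + v2 ^+ 2 - 1)%:P * (beta%:P - 'X))).
  by rewrite /lax_v; ring.
by rewrite vv subrr polyC0 mul0r mulr0.
Qed.

End Matrix.

Let size_CM_linear (c e : F) : (size (c%:P * (e%:P - 'X))%R <= 2)%N.
Proof.
rewrite mul_polyC (leq_trans (size_scale_leq _ _)) //.
by rewrite -opprB size_polyN size_XsubC.
Qed.

Lemma size_lax_u x1 x2 v1 v2 : (size (lax_u x1 x2 v1 v2) <= 2)%N.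
Proof. by rewrite (leq_trans (size_polyD _ _)) // geq_max !size_CM_linear. Qed.

Lemma size_lax_v v1 v2 : (size (lax_v v1 v2) <= 2)%N.
Proof. by rewrite (leq_trans (size_polyD _ _)) // geq_max !size_CM_linear. Qed.

Lemma size_lax_w x1 x2 : (size (lax_w x1 x2) <= 3)%N.
Proof.
have s2 e : size (e%:P - 'X : {poly F}) = 2 by rewrite -opprB size_polyN size_XsubC.
rewrite /lax_w (leq_trans (size_polyD _ _)) // geq_max size_polyN.
rewrite [X in _ && X](leq_trans (size_CM_linear _ _)) // andbT.
rewrite (leq_trans (size_polyD _ _)) // geq_max size_polyN.
rewrite [X in _ && X](leq_trans (size_CM_linear _ _)) // andbT.
by rewrite (leq_trans (size_polyMleq _ _)) // !s2.
Qed.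

Lemma lax_flight_u x1 x2 v1 v2 s :
  lax_u (x1 + s * v1) (x2 + s * v2) v1 v2 = lax_u x1 x2 v1 v2 + s%:P * lax_v v1 v2.
Proof. by rewrite /lax_u /lax_v; ring. Qed.

Lemma lax_flight_w x1 x2 v1 v2 s :
  lax_w (x1 + s * v1) (x2 + s * v2)
  = lax_w x1 x2 - (2 * s)%:P * lax_u x1 x2 v1 v2 - (s ^+ 2)%:P * lax_v v1 v2.
Proof. by rewrite /lax_u /lax_v /lax_w; ring. Qed.

Lemma lax_reflect_u n1 n2 v1 v2 t : a * n1 ^+ 2 + b * n2 ^+ 2 = 1 ->
  'X * lax_u (a * n1) (b * n2) (v1 - t * n1) (v2 - t * n2)
  = 'X * lax_u (a * n1) (b * n2) v1 v2 + t%:P * lax_w (a * n1) (b * n2).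
Proof.
move=> nn; apply/eqP; rewrite -subr_eq0; apply/eqP.
transitivity (t%:P * (a%:P - 'X) * (b%:P - 'X) * (a * n1 ^+ 2 + b * n2 ^+ 2 - 1)%:P).
  by rewrite /lax_u /lax_w; ring.
by rewrite nn subrr polyC0 mulr0.
Qed.

Lemma lax_reflect_v n1 n2 v1 v2 t :
  t * (n1 ^+ 2 + n2 ^+ 2) = 2 * (v1 * n1 + v2 * n2) ->
  'X * lax_v (v1 - t * n1) (v2 - t * n2)
  = 'X * lax_v v1 v2 - t%:P * (lax_u (a * n1) (b * n2) v1 v2
                               + lax_u (a * n1) (b * n2) (v1 - t * n1) (v2 - t * n2)).
Proof.
move=> tn; apply/eqP; rewrite -subr_eq0; apply/eqP.
transitivity (t%:P * (a%:P - 'X) * (b%:P - 'X) *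
  (2 * (v1 * n1 + v2 * n2) - t * (n1 ^+ 2 + n2 ^+ 2))%:P).
  by rewrite /lax_u /lax_v; ring.
by rewrite tn subrr polyC0 mulr0.
Qed.

(* One flight of length [s] followed by a hit with reflection parameter [t]:
   ['X] times the conjugation [1, t / 'X; 0, 1] *m [1, 0; - s, 1]. *)
Definition step_mx (s t : F) : 'M[{poly F}]_2 :=
  \matrix_(i, j) if i == 0 then (if j == 0 then 'X - (t * s)%:P else t%:P)
                 else (if j == 0 then - (s%:P * 'X) else 'X).

Definition lax_mx (x1 x2 v1 v2 : F) : 'M[{poly F}]_2 :=
  \matrix_(i, j) if i == 0 then (if j == 0 then lax_u x1 x2 v1 v2 else lax_v v1 v2)
                 else (if j == 0 then lax_w x1 x2 else - lax_u x1 x2 v1 v2).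

(* The orbit of the magic billiard in coordinates: the k-th flight starts at
   [(ox1 k, ox2 k)] with velocity [(ov1 k, ov2 k)], takes time [os k], and ends at the
   point [(a on1 k, b on2 k)], where [(on1 k, on2 k)] is normal to the ellipse. *)
Record magic_orbit := MagicOrbit {
  ox1 : nat -> F; ox2 : nat -> F; ov1 : nat -> F; ov2 : nat -> F;
  os : nat -> F; ot : nat -> F; on1 : nat -> F; on2 : nat -> F;
  orbit_hit1 : forall k, ox1 k + os k * ov1 k = a * on1 k;
  orbit_hit2 : forall k, ox2 k + os k * ov2 k = b * on2 k;
  orbit_ellipse : forall k, a * on1 k ^+ 2 + b * on2 k ^+ 2 = 1;
  orbit_reflect : forall k,
    ot k * (on1 k ^+ 2 + on2 k ^+ 2) = 2 * (ov1 k * on1 k + ov2 k * on2 k);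
  orbit_x1 : forall k, ox1 k.+1 = - (a * on1 k);
  orbit_x2 : forall k, ox2 k.+1 = b * on2 k;
  orbit_v1 : forall k, ov1 k.+1 = - (ov1 k - ot k * on1 k);
  orbit_v2 : forall k, ov2 k.+1 = ov2 k - ot k * on2 k;
  orbit_s : forall k, os k != 0;
  orbit_t : forall k, ot k != 0 }.

Lemma lax_u_flip y1 y2 w1 w2 : lax_u (- y1) y2 (- w1) w2 = lax_u y1 y2 w1 w2.
Proof. by rewrite /lax_u mulrNN. Qed.

Lemma lax_v_flip w1 w2 : lax_v (- w1) w2 = lax_v w1 w2.
Proof. by rewrite /lax_v sqrrN. Qed.

Lemma lax_w_flip y1 y2 : lax_w (- y1) y2 = lax_w y1 y2.
Proof. by rewrite /lax_w sqrrN. Qed.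

Lemma ord2P (i : 'I_2) : i = 0 \/ i = 1.
Proof. by case: i => [[|[|//]] ?]; [left|right]; apply: val_inj. Qed.

Lemma mulmx2E (R : pzSemiRingType) (A B : 'M[R]_2) i j :
  (A *m B) i j = A i 0 * B 0 j + A i 1 * B 1 j.
Proof.
rewrite mxE !big_ord_recl big_ord0 addr0.
by have -> : fintype.lift ord0 ord0 = 1 :> 'I_2 by apply: val_inj.
Qed.

Lemma matrix2P (R : Type) (A B : 'M[R]_2) :
  A 0 0 = B 0 0 -> A 0 1 = B 0 1 -> A 1 0 = B 1 0 -> A 1 1 = B 1 1 -> A = B.
Proof.
move=> h00 h01 h10 h11; apply/matrixP.
by move=> i j; case: (ord2P i) => ->; case: (ord2P j) => ->.
Qed.

Section Transfer.
Context (o : magic_orbit).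
Local Notation L k := (lax_mx (ox1 o k) (ox2 o k) (ov1 o k) (ov2 o k)).
Local Notation step k := (step_mx (os o k) (ot o k)).

Fixpoint transfer (k : nat) : 'M[{poly F}]_2 :=
  if k is k'.+1 then step k' *m transfer k' else 1%:M.

Lemma step_lax k : step k *m L k = L k.+1 *m step k.
Proof.
have E1 : 'X * lax_u (ox1 o k.+1) (ox2 o k.+1) (ov1 o k.+1) (ov2 o k.+1)
   = 'X * (lax_u (ox1 o k) (ox2 o k) (ov1 o k) (ov2 o k) + (os o k)%:P * lax_v (ov1 o k) (ov2 o k))
     + (ot o k)%:P * lax_w (ox1 o k.+1) (ox2 o k.+1).
  rewrite orbit_x1 orbit_x2 orbit_v1 orbit_v2 lax_u_flip lax_w_flip -lax_flight_u.
  by rewrite orbit_hit1 orbit_hit2 lax_reflect_u // orbit_ellipse.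
have E2 : lax_w (ox1 o k.+1) (ox2 o k.+1) = lax_w (ox1 o k) (ox2 o k)
   - 2 * (os o k)%:P * lax_u (ox1 o k) (ox2 o k) (ov1 o k) (ov2 o k)
   - (os o k)%:P ^+ 2 * lax_v (ov1 o k) (ov2 o k).
  rewrite orbit_x1 orbit_x2 lax_w_flip -orbit_hit1 -orbit_hit2.
  by rewrite (lax_flight_w _ _ (ov1 o k) (ov2 o k)); ring.
have E3 : 'X * lax_v (ov1 o k.+1) (ov2 o k.+1) = 'X * lax_v (ov1 o k) (ov2 o k)
   - (ot o k)%:P * ((lax_u (ox1 o k) (ox2 o k) (ov1 o k) (ov2 o k)
                    + (os o k)%:P * lax_v (ov1 o k) (ov2 o k))
                   + lax_u (ox1 o k.+1) (ox2 o k.+1) (ov1 o k.+1) (ov2 o k.+1)).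
  rewrite orbit_x1 orbit_x2 orbit_v1 orbit_v2 lax_u_flip lax_v_flip -lax_flight_u.
  by rewrite orbit_hit1 orbit_hit2 lax_reflect_v // orbit_reflect.
have [] := step_lax_ring E1 E2 E3.
by move=> e00 e01 e10 e11; apply: matrix2P; rewrite !mulmx2E !mxE /= ?polyCM.
Qed.

Lemma transferS k i j :
  transfer k.+1 i j = step k i 0 * transfer k 0 j + step k i 1 * transfer k 1 j.
Proof. exact: mulmx2E. Qed.

Lemma transfer_lax k : transfer k *m L 0 = L k *m transfer k.
Proof.
elim: k => [|k IH] /=; first by rewrite mul1mx mulmx1.
by rewrite -mulmxA IH !mulmxA step_lax.
Qed.

Lemma transfer_det k :
  transfer k 0 0 * transfer k 1 1 - transfer k 0 1 * transfer k 1 0 = 'X^(k.*2).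
Proof.
elim: k => [|k IH] /=; first by rewrite !mxE /= mulr1 mulr0 subr0.
rewrite doubleS 2!exprS mulrA -IH !mulmx2E.
by move: (transfer k) => M; rewrite !mxE /=; ring.
Qed.

(** At [l = a] a step multiplies [(v1, - x1)] by [a] up to the flip, which negates both entries;
    hence the factor [-a] per hit. At [l = b] the flip leaves the coordinates alone and the factor
    is [b]. This is how the flip enters the algebra. *)
Lemma transfer_at_a k (M := transfer k) :
  (M 0 0).[a] * ov1 o 0 - (M 0 1).[a] * ox1 o 0 = (- a) ^+ k * ov1 o k /\
  (M 1 0).[a] * ov1 o 0 - (M 1 1).[a] * ox1 o 0 = - ((- a) ^+ k * ox1 o k).
Proof.
rewrite /M; elim: k {M} => [|k [IH0 IH1]] /=.
  by rewrite !mxE /= ?mulr1n ?mulr0n !hornerE; split; ring.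
rewrite !mulmx2E; move: (transfer k) IH0 IH1 => M IH0 IH1; rewrite !mxE /=.
have := orbit_hit1 o k; rewrite !hornerE !exprS orbit_x1 orbit_v1 => hit; split.
  transitivity ((a - ot o k * os o k) * ((- a) ^+ k * ov1 o k) + ot o k * - ((- a) ^+ k * ox1 o k)).
    by rewrite -IH0 -IH1; ring.
  transitivity (a * (- a) ^+ k * ov1 o k - ot o k * (- a) ^+ k * (ox1 o k + os o k * ov1 o k)).
    by ring.
  by rewrite hit; ring.
transitivity (- (os o k * a) * ((- a) ^+ k * ov1 o k) + a * - ((- a) ^+ k * ox1 o k)).
  by rewrite -IH0 -IH1; ring.
transitivity (- a * (- a) ^+ k * (ox1 o k + os o k * ov1 o k)); first by ring.
by rewrite hit; ring.
Qed.

Lemma transfer_at_b k (M := transfer k) :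
  (M 0 0).[b] * ov2 o 0 - (M 0 1).[b] * ox2 o 0 = b ^+ k * ov2 o k /\
  (M 1 0).[b] * ov2 o 0 - (M 1 1).[b] * ox2 o 0 = - (b ^+ k * ox2 o k).
Proof.
rewrite /M; elim: k {M} => [|k [IH0 IH1]] /=.
  by rewrite !mxE /= ?mulr1n ?mulr0n !hornerE; split; ring.
rewrite !mulmx2E; move: (transfer k) IH0 IH1 => M IH0 IH1; rewrite !mxE /=.
have := orbit_hit2 o k; rewrite !hornerE !exprS orbit_x2 orbit_v2 => hit; split.
  transitivity ((b - ot o k * os o k) * (b ^+ k * ov2 o k) + ot o k * - (b ^+ k * ox2 o k)).
    by rewrite -IH0 -IH1; ring.
  transitivity (b * b ^+ k * ov2 o k - ot o k * b ^+ k * (ox2 o k + os o k * ov2 o k)).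
    by ring.
  by rewrite hit; ring.
transitivity (- (os o k * b) * (b ^+ k * ov2 o k) + b * - (b ^+ k * ox2 o k)).
  by rewrite -IH0 -IH1; ring.
transitivity (- b * b ^+ k * (ox2 o k + os o k * ov2 o k)); first by ring.
by rewrite hit; ring.
Qed.

(** At [l = 0] each step is the rank one matrix with first row [t (- s, 1)] and second row 0. So the
    product keeps the kernel of its first factor, spanned by [(1, os o 0)]. *)
Lemma transfer_at_0 k : exists2 c, c != 0 &
  [/\ (transfer k.+1 0 0).[0] = - (os o 0 * c), (transfer k.+1 0 1).[0] = c,
      (transfer k.+1 1 0).[0] = 0 & (transfer k.+1 1 1).[0] = 0].
Proof.
elim: k => [|k [c c0 [e00 e01 e10 e11]]].
  exists (ot o 0); first exact: orbit_t.
  by rewrite /= mulmx1 !mxE /= !hornerE; split=> //; ring.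
exists (- (ot o k.+1 * os o k.+1 * c)).
  by rewrite oppr_eq0 !mulf_neq0 ?orbit_s ?orbit_t.
rewrite !(transferS k.+1); move: (transfer k.+1) e00 e01 e10 e11 => M.
rewrite !mxE /= !(hornerD, hornerN, hornerM, hornerX, hornerC) => -> -> -> ->; split; ring.
Qed.

(** The coefficient of [l^k] is unipotent lower triangular. This normalises [p] to be monic, and
    later makes [C] unipotent. *)
Lemma transfer_coef k :
  [/\ forall j, (k < j)%N -> forall i i', (transfer k i i')`_j = 0,
     (transfer k 0 0)`_k = 1, (transfer k 0 1)`_k = 0 & (transfer k 1 1)`_k = 1].
Proof.
elim: k => [|k [IH e00 e01 e11]] /=.
  split; rewrite ?mxE /= ?coefC //.
  by move=> [//|j] _ i i'; rewrite mxE -polyC_natr coefC.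
rewrite !mulmx2E; move: (transfer k) IH e00 e01 e11 => M IH e00 e01 e11.
have IHS j i i' : (k < j)%N -> (M i i')`_j = 0 by move=> kj; apply: IH.
split.
- move=> [//|j]; rewrite ltnS => kj i i'; have kj' := ltnW kj.
  rewrite mulmx2E; case: (ord2P i) => ->; rewrite !mxE /=.
    by rewrite mulrBl coefD coefB !coefCM coefXM /= !IHS // !mulr0 subr0 addr0.
  by rewrite mulNr -mulrA coefD coefN coefCM !coefXM /= !IHS // mulr0 oppr0 addr0.
- by rewrite !mxE /= mulrBl coefD coefB !coefCM coefXM /= e00 !IHS // !mulr0 subr0 addr0.
- by rewrite !mxE /= mulrBl coefD coefB !coefCM coefXM /= e01 !IHS // !mulr0 subr0 addr0.
by rewrite !mxE /= mulNr -mulrA coefD coefN coefCM !coefXM /= e01 e11 mulr0 oppr0 add0r.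
Qed.

End Transfer.
End Lax.

(** * Periodicity and the Pell equation *)

Lemma adjugate_ring (R : comPzRingType) (p q A B C D U V W U' V' : R) :
  A * U + B * W = U' * A + V' * C -> A * V + B * - U = U' * B + V' * D ->
  (B * (p + q * U) - A * (q * V)) * A - (A * (p - q * U) - B * (q * W)) * B
    = - (q * V') * (A * D - B * C) /\
  (D * (p + q * U) - C * (q * V)) * A - (C * (p - q * U) - D * (q * W)) * B
    = (p + q * U') * (A * D - B * C).
Proof.
move=> h0 h1; split.
  transitivity (q * (B * (A * U + B * W) - A * (A * V + B * - U))); first by ring.
  by rewrite h0 h1; ring.
transitivity (p * (A * D - B * C) + q * (D * (A * U + B * W) - C * (A * V + B * - U))).
  by ring.
by rewrite h0 h1; ring.
Qed.

Lemma coefM_top (R : nzRingType) (p q : {poly R}) m n :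
  (size p <= m.+1)%N -> (size q <= n.+1)%N -> (p * q)`_(m + n) = p`_m * q`_n.
Proof.
move=> pm qn; have mi : (m < (m + n).+1)%N by rewrite ltnS leq_addr.
rewrite coefM (bigD1 (Ordinal mi)) //= addKn big1 ?addr0 // => i /eqP im.
have [lt|lt|eq] := ltngtP i m; last by case: im; apply: val_inj.
  by rewrite [q`__]nth_default ?mulr0 // (leq_trans qn) // ltn_subRL ltn_add2r.
by rewrite [p`__]nth_default ?mul0r // (leq_trans pm).
Qed.

(** The vector [(y, - z)] is killed by [L_0], so [P + Q L_0] multiplies it by [P]; the transfer
    matrix, corrected by the flight [c], multiplies it by [e]. *)
Lemma eigen_shift_ring (R : comPzRingType) (P Q u v w c e y z zn : R) :
  u * y = v * z -> w * y = - (u * z) -> zn + c * y = z ->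
  (P + Q * u) * y - Q * v * z = e * y ->
  (Q * w + c * (P + Q * u)) * y - (P - Q * u + c * (Q * v)) * z = - (e * zn) ->
  P * y = e * y /\ P * z = e * z.
Proof.
move=> uv wu zE h1 h2; split.
  by rewrite -h1 mulrDl -!mulrA uv; ring.
have : P * z - Q * (w * y + u * z) = e * zn + c * (e * y).
  by rewrite -h1 -[e * zn]opprK -h2; ring.
by rewrite wu addNr mulr0 subr0 -zE => ->; ring.
Qed.

(** Entries of the relation that [L_0] commutes with the transfer matrix multiplied on the left by
    [(1, 0; - c, 1)], the effect of a flight. *)
Lemma commute_shift_ring (R : comPzRingType) (A B C D U U' V W c : R) :
  U = U' + c * V -> A * U + B * W = U' * A + V * C ->
  A * V + B * - U = U' * B + V * D ->
  B * W = V * (C - c * A) /\ V * (A - (D - c * B)) = 2 * U * B.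
Proof.
move=> UE e00 e01; split.
  rewrite -[B * W](addrK (A * U)) [_ + A * U]addrC e00 UE; ring.
transitivity (A * V + B * - U + B * U - V * D + c * V * B); first by ring.
by rewrite e01 UE; ring.
Qed.

Section LaxPell.
Context {F : fieldType} (a b beta : F) (two : (2 : F) != 0).
Context (o : magic_orbit a b).

Local Notation f := (cubic a b beta).
Local Notation U := (lax_u a b (ox1 o 0) (ox2 o 0) (ov1 o 0) (ov2 o 0)).
Local Notation V := (lax_v a b (ov1 o 0) (ov2 o 0)).
Local Notation W := (lax_w a b (ox1 o 0) (ox2 o 0)).
Local Notation M := (transfer o).

Context (vv : ov1 o 0 ^+ 2 + ov2 o 0 ^+ 2 = 1).
Context (ell : (ox1 o 0 * ov2 o 0 - ox2 o 0 * ov1 o 0) ^+ 2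
               = ov1 o 0 ^+ 2 * (b - beta) + ov2 o 0 ^+ 2 * (a - beta)).

Let curve : U ^+ 2 + V * W = f := lax_curve vv ell.

Let Va1 : U.[a] * ov1 o 0 = V.[a] * ox1 o 0.
Proof. by rewrite /lax_u /lax_v !hornerE subrr !mulr0 !addr0; ring. Qed.
Let Wa1 : W.[a] * ov1 o 0 = - (U.[a] * ox1 o 0).
Proof. by rewrite /lax_u /lax_w !hornerE subrr !mulr0 mul0r addr0; ring. Qed.
Let Vb2 : U.[b] * ov2 o 0 = V.[b] * ox2 o 0.
Proof. by rewrite /lax_u /lax_v !hornerE subrr !mulr0 !add0r; ring. Qed.
Let Wb2 : W.[b] * ov2 o 0 = - (U.[b] * ox2 o 0).
Proof. by rewrite /lax_u /lax_w !hornerE subrr !mulr0 add0r; ring. Qed.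

Lemma periodic_pell (n : nat) (sigma : F) :
  uniq [:: a; b; beta] -> a * b * beta != 0 -> (0 < n)%N ->
  ov1 o n = ov1 o 0 -> ov2 o n = ov2 o 0 ->
  ox1 o n + sigma * ov1 o 0 = ox1 o 0 -> ox2 o n + sigma * ov2 o 0 = ox2 o 0 ->
  exists p q : {poly F}, [/\ p ^+ 2 - f * q ^+ 2 = 'X^(n.*2),
    p.[a] = (- a) ^+ n, p.[b] = b ^+ n, p.[0] != 0 & p \is monic /\ size p = n.+1].
Proof.
move=> euniq e0 n0 ev1 ev2 ex1 ex2.
have Un : U = lax_u a b (ox1 o n) (ox2 o n) (ov1 o n) (ov2 o n) + sigma%:P * V.
  by rewrite ev1 ev2 -lax_flight_u ex1 ex2.
pose N10 := M n 1 0 - sigma%:P * M n 0 0; pose N11 := M n 1 1 - sigma%:P * M n 0 1.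
have [C1 C2] : M n 0 1 * W = V * N10 /\ V * (M n 0 0 - N11) = 2 * U * M n 0 1.
  have com i j := congr1 (fun A : 'M_2 => A i j) (transfer_lax o n).
  have := com 0 0; have := com 0 1; rewrite !mulmx2E !mxE /= ev1 ev2 => c01 c00.
  by rewrite ev1 ev2 in Un; apply: commute_shift_ring Un c00 c01.
pose lam := ov1 o 0 ^+ 2 * b + ov2 o 0 ^+ 2 * a.
have VE : V = - ('X - lam%:P).
  transitivity (lam%:P - (ov1 o 0 ^+ 2 + ov2 o 0 ^+ 2)%:P * 'X); last by rewrite vv mul1r opprB.
  by rewrite /lax_v /lam; ring.
have VN : V != 0 by rewrite VE oppr_eq0 polyXsubC_eq0.
have V0 : V.[lam] = 0 by rewrite VE !hornerE subrr oppr0.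
have [q qE] : exists q, M n 0 1 = q * V.
  (* The candidate [q] is the quotient of the upper right entries of [M] and [L_0]. If [M n 0 1] did
     not vanish at the root [lam] of [V], then [U] and [W] would, and [U^2 + V W = f] would have a
     double root. *)
  suff /factor_theorem[q qE] : root (M n 0 1) lam.
    by exists (- q); rewrite qE VE mulrNN.
  apply/rootP/eqP; apply: contraT => M0.
  have W0 : W.[lam] = 0.
    have /eqP := congr1 (horner^~ lam) C1; rewrite !hornerM V0 mul0r mulf_eq0 (negPf M0).
    by move/eqP.
  have U0 : U.[lam] = 0.
    have /eqP := congr1 (horner^~ lam) C2.
    rewrite !hornerM V0 mul0r eq_sym !mulf_eq0 (negPf M0) orbF -polyC_natr hornerC.
    by rewrite (negPf two) => /eqP.
  have /factor_theorem[u uE] : root U lam by apply/rootP.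
  have /factor_theorem[w wE] : root W lam by apply/rootP.
  have [|k fk /eqP[]] := @cubic_simple_root _ a b beta lam euniq.
    by rewrite -curve hornerD (hornerM V) V0 mul0r addr0 horner_exp U0 expr0n.
  have XN : 'X - lam%:P != 0 :> {poly F} by rewrite polyXsubC_eq0.
  have -> : k = (u ^+ 2 - w) * ('X - lam%:P).
    by apply: (mulfI XN); rewrite -fk -curve uE wE VE; ring.
  by rewrite !hornerE subrr mulr0.
have qW : N10 = q * W by apply: (mulfI VN); rewrite -C1 qE; ring.
have N11E : N11 = M n 0 0 - 2 * q * U.
  apply: (mulfI VN); apply/esym/subr0_eq.
  rewrite -[RHS](subrr (V * (M n 0 0 - N11))) {2}C2 qE; ring.
pose p := M n 0 0 - q * U.
have M00 : M n 0 0 = p + q * U by rewrite subrK.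
have {}N11E : N11 = p - q * U by rewrite N11E M00; ring.
have deg := transfer_coef o n.
have pell : p ^+ 2 - f * q ^+ 2 = 'X^(n.*2).
  rewrite -(transfer_det o) -curve.
  transitivity (M n 0 0 * N11 - M n 0 1 * N10); last by rewrite /N10 /N11; ring.
  by rewrite N11E qW qE M00; ring.
have [a0 [b0 beta0]] : a != 0 /\ b != 0 /\ beta != 0.
  by move: e0; rewrite !mulf_eq0 !negb_or => /andP[/andP[-> ->] ->].
have scal (e c y z : F) : (y != 0) || (z != 0) -> c * y = e * y -> c * z = e * z -> c = e.
  by case/orP => [y0 /(mulIf y0)|z0 _ /(mulIf z0)].
have ev z : [/\ (M n 0 0).[z] = p.[z] + q.[z] * U.[z], (M n 0 1).[z] = q.[z] * V.[z],
    (M n 1 0).[z] = q.[z] * W.[z] + sigma * (p.[z] + q.[z] * U.[z])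
    & (M n 1 1).[z] = p.[z] - q.[z] * U.[z] + sigma * (q.[z] * V.[z])].
  rewrite -!hornerM -hornerD -M00 -qE -qW -hornerN -hornerD -N11E /N10 /N11.
  by rewrite !hornerD !hornerN !hornerM !hornerC !subrK.
exists p, q; split=> //.
- have [h1 h2] := transfer_at_a o n; move: h1 h2.
  have [-> -> -> ->] := ev a; rewrite ev1 => h1 h2.
  (* Otherwise the line is the axis [x1 = 0], and the tangency equation gives [beta = a]. *)
  have nz : (ov1 o 0 != 0) || (ox1 o 0 != 0).
    apply: contraT; rewrite negb_or !negbK => /andP[/eqP v10 /eqP x10].
    move: ell vv euniq; rewrite v10 x10 expr0n mul0r mulr0 subrr expr0n mul0r !add0r => /eqP + v2.
    by rewrite v2 mul1r /= eq_sym subr_eq0 !inE => /eqP ->; rewrite eqxx orbT.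
  have [hv hx] := eigen_shift_ring Va1 Wa1 ex1 h1 h2.
  exact: (scal _ _ _ _ nz).
- have [h1 h2] := transfer_at_b o n; move: h1 h2.
  have [-> -> -> ->] := ev b; rewrite ev2 => h1 h2.
  have nz : (ov2 o 0 != 0) || (ox2 o 0 != 0).
    apply: contraT; rewrite negb_or !negbK => /andP[/eqP v20 /eqP x20].
    move: ell vv euniq; rewrite v20 x20 expr0n mul0r mulr0 subrr expr0n mul0r !addr0 => /eqP + v2.
    by rewrite v2 mul1r /= eq_sym subr_eq0 !inE => /eqP ->; rewrite eqxx andbF.
  have [hv hx] := eigen_shift_ring Vb2 Wb2 ex2 h1 h2.
  exact: (scal _ _ _ _ nz).
(* If [p(0) = 0], the Pell equation gives [q(0) = 0], so the entry [q V] of [M] vanishes at 0,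
   against [transfer_at_0]. *)
- apply/eqP => p0; have [c + ] := transfer_at_0 o n.-1.
  rewrite prednK // => /negP + [_ e01 _ _]; apply; rewrite -{}e01.
  have [_ -> _ _] := ev 0.
  have /eqP := congr1 (horner^~ 0) pell.
  rewrite hornerD hornerN !horner_exp hornerM horner_exp p0 hornerX !expr0n double_eq0.
  rewrite (gtn_eqF n0) /= sub0r oppr_eq0 /cubic !hornerM !hornerD !hornerN !hornerC hornerX !subr0.
  by rewrite mulf_eq0 (negPf e0) expf_eq0 /= => /eqP ->; rewrite mul0r.
have [hi d00 d01 d11] := deg.
(* As [L_0] has trace 0, [2 p] is the trace of the corrected matrix, whose leading coefficient is
   known. *)
have p2 : p *+ 2 = M n 0 0 + N11 by rewrite M00 N11E; ring.
have pj j : p`_j *+ 2 = (M n 0 0)`_j + ((M n 1 1)`_j - sigma * (M n 0 1)`_j).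
  by rewrite -coefMn p2 coefD coefB coefCM.
have pn : p`_n = 1.
  by apply: (mulIf two); rewrite mulr_natr pj d00 d11 d01 mulr0 subr0 mul1r.
have sp : size p = n.+1.
  apply/eqP; rewrite eqn_leq; apply/andP; split.
    apply/leq_sizeP => j nj; apply: (mulIf two).
    by rewrite mulr_natr pj !hi // mulr0 subr0 addr0 mul0r.
  by rewrite ltnNge; apply: contra_eqN pn => /leq_sizeP -> //; rewrite eq_sym oner_eq0.
by rewrite monicE lead_coefE sp pn eqxx.
Qed.

(* [kappa] is the eigenvalue of [L_0] at [0] on the kernel of the transfer matrix.
   The rows of [M adj(M')], for [M' = p + q L_0], kill two independent vectors
   modulo ['X] as long as they are not divisible by ['X^(2n)]. *)
Lemma pell_periodic (n : nat) (p q : {poly F}) (kappa := U.[0] + os o 0 * V.[0]) :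
  (0 < n)%N -> a != 0 -> b != 0 ->
  p ^+ 2 - f * q ^+ 2 = 'X^(n.*2) -> (size p <= n.+1)%N -> p`_n = 1 ->
  (size q <= n.-1)%N -> p.[0] != 0 -> p.[0] + q.[0] * kappa = 0 ->
  p.[a] = (- a) ^+ n -> p.[b] = b ^+ n ->
  exists c, [/\ ov1 o n = ov1 o 0, ov2 o n = ov2 o 0,
    ox1 o n = ox1 o 0 - c * ov1 o 0 & ox2 o n = ox2 o 0 - c * ov2 o 0].
Proof.
move=> n0 a0 b0 pell sp pn sq p00 ker pa pb.
pose X1 i := M n i 0 * (p - q * U) - M n i 1 * (q * W).
pose X2 i := M n i 1 * (p + q * U) - M n i 0 * (q * V).
have pell' : (p + q * U) * (p - q * U) - q * q * V * W = 'X^(n.*2).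
  by rewrite -pell -curve; ring.
have R1 i : X1 i * (p + q * U) + X2 i * (q * W) = M n i 0 * 'X^(n.*2).
  by rewrite -pell' /X1 /X2; ring.
have R2 i : X1 i * (q * V) + X2 i * (p - q * U) = M n i 1 * 'X^(n.*2).
  by rewrite -pell' /X1 /X2; ring.
(* By [M L_0 = L_n M], the matrix [M adj(M')] is [(p - q L_n) M]. Its rows are combinations of those
   of [M], so their determinants with row 0 of [M] are multiples of [det M]. *)
have R3 i : exists E, X2 i * M n 0 0 - X1 i * M n 0 1 = E * 'X^(n.*2).
  have com i' j := congr1 (fun A : 'M_2 => A i' j) (transfer_lax o n).
  have := com 0 0; have := com 0 1; rewrite !mulmx2E !mxE /= => c01 c00.
  rewrite -(transfer_det o n) /X1 /X2; case: (ord2P i) => ->.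
    exists (- (q * lax_v a b (ov1 o n) (ov2 o n))).
    exact: (adjugate_ring p q c00 c01).1.
  exists (p + q * lax_u a b (ox1 o n) (ox2 o n) (ov1 o n) (ov2 o n)).
  exact: (adjugate_ring p q c00 c01).2.
(* Factors ['X] are stripped one at a time. At 0, [R3] gives [y1 = - s y2] with [s = os o 0], and
   [R2] then gives [2 p(0) y2 = 0] by the choice of [kappa]. *)
have div i : exists C1 C2, X1 i = 'X^(n.*2) * C1 /\ X2 i = 'X^(n.*2) * C2.
  have : (n.*2 <= n.*2)%N by [].
  elim: {-2}(n.*2) => [|j IH] jn; first by exists (X1 i), (X2 i); rewrite !mul1r.
  have [Y1 [Y2 [E1 E2]]] := IH (ltnW jn).
  have XjE : 'X^(n.*2) = 'X^j * ('X * 'X^(n.*2 - j.+1)) :> {poly F}.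
    by rewrite -exprS -exprD -subSn // subSS subnKC // ltnW.
  have XN : 'X^j != 0 :> {poly F} by rewrite expf_neq0 // polyX_eq0.
  have S2 : Y1 * (q * V) + Y2 * (p - q * U) = M n i 1 * ('X * 'X^(n.*2 - j.+1)).
    apply: (mulfI XN).
    transitivity ('X^j * Y1 * (q * V) + 'X^j * Y2 * (p - q * U)); first by ring.
    by rewrite -E1 -E2 R2 XjE; ring.
  have [E S3] : exists E, Y2 * M n 0 0 - Y1 * M n 0 1 = E * ('X * 'X^(n.*2 - j.+1)).
    have [E h] := R3 i; exists E; apply: (mulfI XN).
    transitivity ('X^j * Y2 * M n 0 0 - 'X^j * Y1 * M n 0 1); first by ring.
    by rewrite -E1 -E2 h XjE; ring.
  have [c + ] := transfer_at_0 o n.-1; rewrite prednK // => c0 [e00 e01 _ _].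
  have at0 (A B : {poly F}) : (A * ('X * B)).[0] = 0 by rewrite !hornerM hornerX mul0r mulr0.
  have y1E : Y1.[0] = - (os o 0 * Y2.[0]).
    have h : Y2.[0] * (M n 0 0).[0] - Y1.[0] * (M n 0 1).[0] = 0.
      by rewrite -!hornerM -hornerN -hornerD S3 at0.
    apply: (mulIf c0); apply: subr0_eq; rewrite e00 e01 in h.
    by apply: oppr_inj; rewrite oppr0 -[RHS]h; ring.
  have y2 : Y2.[0] = 0.
    have h : Y1.[0] * (q.[0] * V.[0]) + Y2.[0] * (p.[0] - q.[0] * U.[0]) = 0.
      by rewrite -!hornerM -hornerN -hornerD -!hornerM -hornerD S2 at0.
    rewrite y1E in h.
    apply: (mulIf (mulf_neq0 two p00)); rewrite mul0r -[RHS]h.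
    transitivity (Y2.[0] * (2 * p.[0] - (p.[0] + q.[0] * kappa))).
      by rewrite ker subr0.
    by rewrite /kappa; ring.
  have root0 (Y : {poly F}) : Y.[0] = 0 -> exists Z, Y = 'X * Z.
    by move=> /rootP/factor_theorem[Z ->]; exists Z; rewrite polyC0 subr0 mulrC.
  have [Z1 Z1E] : exists Z, Y1 = 'X * Z by apply: root0; rewrite y1E y2 mulr0 oppr0.
  have [Z2 Z2E] := root0 _ y2.
  by exists Z1, Z2; rewrite E1 E2 Z1E Z2E exprSr !mulrA.
have [hi d00 d01 d11] := transfer_coef o n.
have sM i j : (size (M n i j) <= n.+1)%N by apply/leq_sizeP => k nk; apply: hi.
have sqM (k : nat) (P : {poly F}) : (size P <= k.+1)%N -> (size (q * P)%R <= n.-1 + k)%N.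
  by move=> Pk; have := size_polyMleq q P; move: sq Pk; lia.
have sqU : (size (q * U)%R <= n)%N by rewrite -[n]prednK // -addn1 sqM // size_lax_u.
have sqV : (size (q * V)%R <= n)%N by rewrite -[n]prednK // -addn1 sqM // size_lax_v.
have sqW : (size (q * W)%R <= n.+1)%N.
  by rewrite -[n]prednK // -addn2 sqM // size_lax_w.
have sP : (size (p - q * U)%R <= n.+1)%N.
  by rewrite (leq_trans (size_polyD _ _)) // geq_max sp size_polyN leqW.
have sP' : (size (p + q * U)%R <= n.+1)%N.
  by rewrite (leq_trans (size_polyD _ _)) // geq_max sp leqW.
(* The entries of [M adj(M')] have degree at most [2n], so the cofactors of ['X^(2n)] are
   constants. *)
have const i : exists c1 c2, X1 i = 'X^(n.*2) * c1%:P /\ X2 i = 'X^(n.*2) * c2%:P.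
  have [C1 [C2 [E1 E2]]] := div i.
  have size_const (C : {poly F}) : (size ('X^(n.*2) * C)%R <= n.*2.+1)%N -> C = (C`_0)%:P.
    have [->|CN] := eqVneq C 0; first by rewrite coef0 polyC0.
    rewrite size_monicM ?monicXn // size_polyXn addSn /= -addn1 leq_add2l => sC.
    exact: size1_polyC.
  have sX (i' j' : 'I_2) (P Q : {poly F}) : (size P <= n.+1)%N -> (size Q <= n.+1)%N ->
      (size (M n i i' * P - M n i j' * Q)%R <= n.*2.+1)%N.
    move=> Pn Qn; rewrite (leq_trans (size_polyD _ _)) // geq_max size_polyN.
    have szM (A B : {poly F}) : (size A <= n.+1)%N -> (size B <= n.+1)%N ->
        (size (A * B)%R <= n.*2.+1)%N.
      by move=> An Bn; have := size_polyMleq A B; move: An Bn; lia.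
    by rewrite !szM.
  exists C1`_0, C2`_0; rewrite E1 E2; split; congr (_ * _); apply: size_const.
    by rewrite -E1 sX.
  by rewrite -E2 sX // leqW.
have top i : (X1 i)`_(n.*2) = (M n i 0)`_n - (M n i 1)`_n * (q * W)`_n /\
             (X2 i)`_(n.*2) = (M n i 1)`_n.
  have cP : (p - q * U)`_n = 1 by rewrite coefB pn [_`_n]nth_default ?subr0.
  have cP' : (p + q * U)`_n = 1 by rewrite coefD pn [_`_n]nth_default ?addr0.
  have cV : (q * V)`_n = 0 by rewrite nth_default.
  rewrite -addnn /X1 /X2 !coefB !coefM_top // 1?leqW //.
  by rewrite cP cP' cV !mulr1 mulr0 subr0.
have {}const i : X1 i = 'X^(n.*2) * ((M n i 0)`_n - (M n i 1)`_n * (q * W)`_n)%:P /\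
                 X2 i = 'X^(n.*2) * ((M n i 1)`_n)%:P.
  have [c1 [c2 [E1 E2]]] := const i; have [t1 t2] := top i.
  have cX c : ('X^(n.*2) * c%:P : {poly F})`_(n.*2) = c by rewrite coefXnM ltnn subnn coefC.
  by rewrite -t1 -t2 E1 E2 !cX.
have XN : 'X^(n.*2) != 0 :> {poly F} by rewrite expf_neq0 // polyX_eq0.
have Mrow i : exists c1 c2, [/\ c2 = (M n i 1)`_n,
     c1 = (M n i 0)`_n - (M n i 1)`_n * (q * W)`_n,
     M n i 0 = c1%:P * (p + q * U) + c2%:P * (q * W)
   & M n i 1 = c1%:P * (q * V) + c2%:P * (p - q * U)].
  have [E1 E2] := const i.
  exists ((M n i 0)`_n - (M n i 1)`_n * (q * W)`_n), ((M n i 1)`_n); split=> //.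
    by apply: (mulIf XN); rewrite -R1 E1 E2; ring.
  by apply: (mulIf XN); rewrite -R2 E1 E2; ring.
(* Leading coefficients identify the constant matrix in [M = C M'] as [(1, 0; c, 1)]. *)
have [c1 [c2 [c2E c1E M00 M01]]] := Mrow 0.
have [c [c3 [c3E _ M10 M11]]] := Mrow 1.
rewrite c2E d01 {c2 c2E} in M00 M01; rewrite c1E d00 d01 mul0r subr0 {c1 c1E} in M00 M01.
rewrite c3E d11 {c3 c3E} in M10 M11.
have ev z : [/\ (M n 0 0).[z] = p.[z] + q.[z] * U.[z], (M n 0 1).[z] = q.[z] * V.[z],
    (M n 1 0).[z] = c * (p.[z] + q.[z] * U.[z]) + q.[z] * W.[z]
    & (M n 1 1).[z] = c * (q.[z] * V.[z]) + (p.[z] - q.[z] * U.[z])].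
  rewrite M00 M01 M10 M11; move: U V W => u v w.
  by rewrite !(hornerD, hornerN, hornerM, hornerC) !mul1r !mul0r !addr0.
(* At [z = a] or [b] the vector [(y, - x')] is killed by [L_0], so [M'] multiplies it by [e];
   cancelling [e] leaves the action of [C]. *)
have fin (z y x' yn xn e : F) : e != 0 -> p.[z] = e ->
    U.[z] * y = V.[z] * x' -> W.[z] * y = - (U.[z] * x') ->
    (M n 0 0).[z] * y - (M n 0 1).[z] * x' = e * yn ->
    (M n 1 0).[z] * y - (M n 1 1).[z] * x' = - (e * xn) -> yn = y /\ xn = x' - c * y.
  move=> e0 pz UV WU; have [-> -> -> ->] := ev z; rewrite pz => h1 h2.
  have yE : yn = y.
    apply: (mulfI e0); rewrite -h1; transitivity (e * y + q.[z] * (U.[z] * y - V.[z] * x')).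
      by ring.
    by rewrite UV subrr mulr0 addr0.
  split=> //; apply: (mulfI e0); apply: oppr_inj; rewrite -h2.
  transitivity (- (e * (x' - c * y)) + q.[z] * (W.[z] * y + U.[z] * x')
                + c * q.[z] * (U.[z] * y - V.[z] * x')); first by ring.
  by rewrite UV WU subrr addNr !mulr0 !addr0.
have [ha1 ha2] := transfer_at_a o n; have [hb1 hb2] := transfer_at_b o n.
have aN : - a != 0 by rewrite oppr_eq0.
have [e1 e2] := fin a _ _ _ _ _ (expf_neq0 n aN) pa Va1 Wa1 ha1 ha2.
have [e3 e4] := fin b _ _ _ _ _ (expf_neq0 n b0) pb Vb2 Wb2 hb1 hb2.
by exists c.
Qed.

End LaxPell.

(** * Parity and square roots of solutions of the Pell equation *)

(** A root [z] of [h] is not a root of [g], hence is at least double in [h]; removing [('X - z)^2]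
    from [h] and from [q^2] gives the induction. *)
Lemma coprime_square (K : closedFieldType) (g h q : {poly K}) : g * h = q ^+ 2 ->
  (forall z, root g z -> root h z -> False) -> exists r, h = r ^+ 2.
Proof.
elim: {h}(size h) {-2}h (leqnn (size h)) g q => [|n IH] h hn g q ghq cop.
  by exists 0; apply/eqP; rewrite expr0n -size_poly_eq0 -leqn0.
have [/size_poly1P[c c0 ->]|/closed_rootP[z hz]] := boolP (size h == 1)%N.
  by have [d <-] := closed_field_sqrt c; exists d%:P; rewrite polyC_exp.
have [h0|hN] := eqVneq h 0; first by exists 0; rewrite h0 expr0n.
have gz : g.[z] != 0 by apply/negP => gz; apply: (cop z).
have XN : 'X - z%:P != 0 :> {poly K} by rewrite polyXsubC_eq0.
have /factor_theorem[h1 h1E] := hz.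
have /factor_theorem[q1 q1E] : root q z.
  by rewrite /root -sqrf_eq0 -horner_exp -ghq hornerM (rootP hz) mulr0.
have E1 : g * h1 = q1 ^+ 2 * ('X - z%:P).
  by apply: (mulIf XN); rewrite -mulrA -h1E ghq q1E; ring.
have /factor_theorem[h2 h2E] : root h1 z.
  have /eqP := congr1 (horner^~ z) E1.
  by rewrite !hornerM !hornerE subrr mulr0 mulf_eq0 (negPf gz).
have E2 : g * h2 = q1 ^+ 2 by apply: (mulIf XN); rewrite -E1 h2E mulrA.
have h2N : h2 != 0 by apply: contraNneq hN => h20; rewrite h1E h2E h20 !mul0r.
have [||r rE] := IH h2 _ g q1 E2.
- move: hn; rewrite h1E h2E -mulrA size_mul ?mulf_neq0 // size_mul // !size_XsubC /=.
  by rewrite addn3 /= ltnS => /ltnW.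
- by move=> y gy h2y; apply: (cop y) => //; rewrite h1E h2E !rootM h2y.
by exists (r * ('X - z%:P)); rewrite h1E h2E rE; ring.
Qed.

Lemma pell_square_root (K : closedFieldType) (e1 e2 e3 : K) (n : nat) (p q : {poly K}) :
  (2 : K) != 0 -> uniq [:: e1; e2; e3] -> (0 < n)%N ->
  p ^+ 2 - cubic e1 e2 e3 * q ^+ 2 = 'X^(n.*2) -> p.[0] != 0 ->
  p.[e1] = e1 ^+ n -> p.[e2] = e2 ^+ n -> p.[e3] = e3 ^+ n ->
  exists r s, r ^+ 2 - cubic e1 e2 e3 * s ^+ 2 = 'X^n /\ r.[0] != 0.
Proof.
move=> two; rewrite /= !inE negb_or andbT => /andP[/andP[e12 e13] e23] n0 pell p0 p1 p2 p3.
have [g gE] : exists g, p - 'X^n = cubic e1 e2 e3 * g.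
  have /factor_theorem[g1 g1E] : root (p - 'X^n) e1 by rewrite /root !hornerE p1 subrr.
  have /factor_theorem[g2 g2E] : root g1 e2.
    have /eqP := congr1 (horner^~ e2) g1E.
    by rewrite !hornerE p2 subrr eq_sym mulf_eq0 subr_eq0 [e2 == _]eq_sym (negPf e12) orbF.
  have /factor_theorem[g3 g3E] : root g2 e3.
    have /eqP := congr1 (horner^~ e3) g1E.
    rewrite g2E !hornerE p3 subrr eq_sym !mulf_eq0 !subr_eq0.
    by rewrite ![e3 == _]eq_sym (negPf e13) (negPf e23) !orbF.
  by exists (- g3); rewrite g1E g2E g3E /cubic; ring.
have fN : cubic e1 e2 e3 != 0 by rewrite -size_poly_gt0 size_cubic.
have E : g * (p + 'X^n) = q ^+ 2.
  apply: (mulfI fN); rewrite mulrA -gE.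
  transitivity (p ^+ 2 - 'X^(n.*2)); last by rewrite -pell; ring.
  by rewrite -addnn exprD; ring.
(* A common zero satisfies [p(z) = z^n = - z^n], so [z = 0], which [p(0) != 0] excludes. *)
have cop z : root g z -> root (p + 'X^n) z -> False.
  move=> gz /rootP; rewrite !hornerE => hz.
  have := congr1 (horner^~ z) gE; rewrite hornerM (rootP gz) mulr0 !hornerE => /subr0_eq pz.
  have /eqP : 2 * z ^+ n = 0 by rewrite -hz pz; ring.
  rewrite mulf_eq0 (negPf two) expf_eq0 n0 /= => /eqP z0.
  by move: p0; rewrite -z0 pz z0 expr0n (gtn_eqF n0) eqxx.
have [R RE] := coprime_square E cop.
have [S SE] : exists S, g = S ^+ 2.
  by apply: (@coprime_square _ (p + 'X^n) g q) => [|z hz gz]; [rewrite mulrC|apply: (cop z)].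
(* The difference of [p + 'X^n] and [p - 'X^n] is [2 'X^n], hence a scaling by the square root of
   2. *)
have [c cE] := closed_field_sqrt (2 : K).
have cN : c != 0 by apply: contraNneq two => c0; rewrite -cE c0 expr0n.
exists (c^-1 *: R), (c^-1 *: S); split.
  rewrite !exprZn -scalerAr -scalerBr exprVn cE -RE -SE -gE.
  by apply: (scalerI two); rewrite scalerA divff // scale1r scaler_nat; ring.
rewrite hornerZ mulf_neq0 ?invr_eq0 // -sqrf_eq0 -horner_exp -RE !hornerE expr0n (gtn_eqF n0).
by rewrite addr0.
Qed.

Section Parity.
Context {R : realType} (a b beta : R) (hb : 0 < b) (hab : b < a).
Context (hbeta : 0 < beta < b \/ b < beta < a).
Context (n : nat) (p q : {poly R}).
Local Notation f := (cubic a b beta).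
Context (pell : p ^+ 2 - f * q ^+ 2 = 'X^(n.*2)) (p0 : p.[0] != 0).

(* On an interval where [f >= 0] the equation gives [p^2 >= x^(2n)]. *)
Lemma pell_same_sign (u v : R) : u <= v ->
  (forall x : R, u <= x <= v -> 0 <= f.[x]) -> 0 < p.[u] * p.[v].
Proof.
move=> uv f0; rewrite ltNge; apply/negP => /(polyrcf.poly_ivt uv)[x].
rewrite in_itv /= => /f0 fx /rootP px.
have := congr1 (horner^~ x) pell; rewrite hornerD hornerN !horner_exp hornerM horner_exp px.
rewrite hornerX expr0n sub0r => E.
have : x ^+ n.*2 == 0.
  by rewrite eq_le -{1}E oppr_le0 mulr_ge0 ?sqr_ge0 //= -muln2 exprM sqr_ge0.
by rewrite expf_eq0 => /andP[_ /eqP x0]; move: p0; rewrite x0 in px; rewrite px eqxx.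
Qed.

Lemma pell_at_root (e : R) : f.[e] = 0 -> 0 < p.[e] -> 0 < e -> p.[e] = e ^+ n.
Proof.
move=> fe pe e0; have := congr1 (horner^~ e) pell.
rewrite hornerD hornerN !horner_exp hornerM horner_exp fe mul0r subr0 hornerX -muln2 exprM.
by move/eqP; rewrite eqf_sqr => /orP[/eqP //|/eqP E]; move: pe; rewrite E oppr_gt0 ltNge exprn_ge0 ?ltW.
Qed.

(** A monic polynomial of degree [n] has the sign [(-1)^n] far to the left; such a [z] is the left
    end of an interval for [pell_same_sign]. *)
Lemma pell_far_left : p \is monic -> size p = n.+1 -> forall e : R,
  exists2 z : R, z <= e & 0 < (-1) ^+ n * p.[z].
Proof.
move=> pm sp e; pose P := (-1) ^+ n *: (p \Po (- 'X)).
have sX : size (- 'X : {poly R}) = 2 by rewrite size_polyN size_polyX.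
have lP : lead_coef P = 1.
  rewrite lead_coefZ lead_coef_comp ?sX // (monicP pm) sp mul1r lead_coefN lead_coefX.
  by rewrite -exprMn mulrNN mulr1 expr1n.
have [|M PM] := @polyrcf.poly_pinfty_gt_lc _ P; first by rewrite lP.
exists (Num.min (- M) e); first by rewrite ge_min lexx orbT.
have := PM (- Num.min (- M) e); rewrite lerNr ge_min lexx => /(_ isT).
rewrite lP /P hornerZ horner_comp !hornerE opprK; apply: lt_le_trans ltr01.
Qed.

(** [f] is nonnegative left of its least root and between the other two. For [beta < b], the
    interval [[b, a]] compares [b^n] with [(-a)^n], so [n] is even, and then the left ray gives
    [p(beta) > 0]. For [b < beta], the left ray up to [b] gives the parity and [[beta, a]] the
    sign. *)
Lemma pell_parity : p \is monic -> size p = n.+1 ->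
  p.[a] = (- a) ^+ n -> p.[b] = b ^+ n -> ~~ odd n /\ p.[beta] = beta ^+ n.
Proof.
move=> pm sp pa pb; have a0 : 0 < a by apply: lt_trans hab.
have fE x : f.[x] = (a - x) * (b - x) * (beta - x) by rewrite /cubic !hornerE.
have fb : f.[beta] = 0 by rewrite fE subrr mulr0.
have bn : 0 < b ^+ n by rewrite exprn_gt0.
have evn : 0 < (- a) ^+ n -> ~~ odd n.
  by apply: contraL => on; rewrite -leNgt exprNn -signr_odd on expr1 mulN1r oppr_le0 exprn_ge0 // ltW.
have [/andP[beta0 bb]|/andP[bb ba]] := hbeta.
  have on : ~~ odd n.
    apply: evn; have := @pell_same_sign b a (ltW hab); rewrite pb pa pmulr_rgt0 //; apply.
    move=> x /andP[bx xa]; rewrite fE -mulrA mulr_ge0 ?mulr_le0 //; lra.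
  split=> //; apply: pell_at_root => //.
  have [z zb pz] := pell_far_left pm sp beta.
  have := @pell_same_sign z beta zb; rewrite pmulr_rgt0; last first.
    by move: pz; rewrite -signr_odd (negPf on) mul1r.
  apply=> x /andP[_ xb]; have xb' := ltW (le_lt_trans xb bb).
  by rewrite fE !mulr_ge0 ?subr_ge0 // (le_trans xb') // ltW.
have [z zb pz] := pell_far_left pm sp b.
have on : ~~ odd n.
  have := @pell_same_sign z b zb; rewrite pb pmulr_lgt0 // => H.
  apply: contraL pz => on; rewrite -signr_odd on expr1 mulN1r oppr_gt0 -leNgt ltW // H //.
  by move=> x /andP[_ xb]; rewrite fE !mulr_ge0 ?subr_ge0 // (le_trans xb) // ltW.
split=> //; apply: pell_at_root => //; last exact: lt_trans bb.
have := @pell_same_sign beta a (ltW ba); rewrite pa pmulr_lgt0; last first.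
  by rewrite exprNn -signr_odd (negPf on) mul1r exprn_gt0.
apply=> x /andP[bx xa]; rewrite fE -mulrA mulr_ge0 ?mulr_le0 //; lra.
Qed.

End Parity.

(** * The orbit of a trajectory *)

(** The first hit lies on the ellipse, so [W] vanishes there at [l = 0]. This says that
    [(1, os o 0)] is an eigenvector of [L_0] at 0 with eigenvalue [kappa], and
    [kappa^2 = - det L_0]. *)
Lemma kappa_sqr (F : fieldType) (a b : F) (o : magic_orbit a b)
    (U := lax_u a b (ox1 o 0) (ox2 o 0) (ov1 o 0) (ov2 o 0))
    (V := lax_v a b (ov1 o 0) (ov2 o 0)) (W := lax_w a b (ox1 o 0) (ox2 o 0)) :
  (U.[0] + os o 0 * V.[0]) ^+ 2 = (U ^+ 2 + V * W).[0].
Proof.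
have W0 : W.[0] - 2 * os o 0 * U.[0] - os o 0 ^+ 2 * V.[0] = 0.
  have /(congr1 (horner^~ 0)) := lax_flight_w a b (ox1 o 0) (ox2 o 0) (ov1 o 0) (ov2 o 0) (os o 0).
  rewrite orbit_hit1 orbit_hit2 -/U -/V -/W; move: U V W => U V W.
  rewrite /lax_w !hornerE => <-.
  transitivity (a * b * (1 - (a * on1 o 0 ^+ 2 + b * on2 o 0 ^+ 2))); first by ring.
  by rewrite orbit_ellipse subrr mulr0.
move: W0; move: U V W => U V W W0; rewrite hornerD horner_exp hornerM.
apply: subr0_eq.
transitivity (- V.[0] * (W.[0] - 2 * os o 0 * U.[0] - os o 0 ^+ 2 * V.[0])); first by ring.
by rewrite W0 mulr0.
Qed.

(** Moves the orbit to the algebraically closed field in which the Pell solution has its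
    coefficients. *)
Definition magic_orbit_map (F G : fieldType) (phi : {rmorphism F -> G}) (a b : F)
    (o : magic_orbit a b) : magic_orbit (phi a) (phi b).
Proof.
pose H := (rmorphM phi, rmorphD phi, rmorphN phi, rmorph1 phi).
exists (phi \o ox1 o) (phi \o ox2 o) (phi \o ov1 o) (phi \o ov2 o)
       (phi \o os o) (phi \o ot o) (phi \o on1 o) (phi \o on2 o) => k /=.
- by rewrite -!H orbit_hit1.
- by rewrite -!H orbit_hit2.
- by rewrite -!rmorphXn -!H orbit_ellipse.
- by rewrite -!rmorphXn -(rmorph_nat phi 2) -!H orbit_reflect.
- by rewrite orbit_x1 !H.
- by rewrite orbit_x2 !H.
- by rewrite orbit_v1 rmorphN rmorphB rmorphM.
- by rewrite orbit_v2 rmorphB rmorphM.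
- by rewrite fmorph_eq0 orbit_s.
by rewrite fmorph_eq0 orbit_t.
Defined.

Section Geometry.
Context {R : realType} (a b : R) (hb : 0 < b) (hab : b < a).
Context (T : magic_trajectory a b).

Let a0 : 0 < a := lt_trans hb hab.
Let aN : a != 0 := lt0r_neq0 a0.
Let bN : b != 0 := lt0r_neq0 hb.

Local Notation hit k := (advance (pos T k) (flight T k) (vel T k)).

Lemma ellipse_advance (P v : plane) (s : R) :
  ellipse_form a b (advance P s v)
  = ellipse_form a b P + 2 * s * dot v (normal a b P) + s ^+ 2 * ellipse_form a b v.
Proof.
by rewrite /ellipse_form /advance /dot /normal /=; field; rewrite aN bN.
Qed.

Lemma ellipse_form_gt0 (v : plane) : dot v v = 1 -> 0 < ellipse_form a b v.
Proof.
rewrite /dot /ellipse_form => vv.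
rewrite lt_def addr_ge0 ?divr_ge0 ?sqr_ge0 ?ltW // andbT.
apply/eqP => /eqP; rewrite paddr_eq0 ?divr_ge0 ?sqr_ge0 ?ltW //.
rewrite !mulf_eq0 !invr_eq0 (negPf aN) (negPf bN) !orbF !orbb => /andP[/eqP v1 /eqP v2].
by move: vv; rewrite v1 v2 mulr0 addr0 => /esym/eqP; rewrite oner_eq0.
Qed.

(** Half a flight before the hit the particle is inside; expanding the form backwards from the hit
    makes the linear coefficient positive. This gives a nonzero reflection parameter. *)
Lemma hit_outwards k : 0 < dot (vel T k) (normal a b (hit k)).
Proof.
have fl := flight_gt0 T k; pose d := flight T k / 2.
have d0 : 0 < d by rewrite divr_gt0.
have : ellipse_form a b (advance (hit k) (- d) (vel T k)) < 1.
  have -> : advance (hit k) (- d) (vel T k) = advance (pos T k) d (vel T k).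
    by rewrite /advance /=; congr (_, _); rewrite /d; field.
  by apply: flight_interior; rewrite d0 ltr_pdivrMr // ltr_pMr // ltr1n.
rewrite ellipse_advance flight_hits -addrA gtrDl sqrrN mulrN mulNr addrC subr_lt0 => lt.
have : 0 < 2 * d * dot (vel T k) (normal a b (hit k)).
  by apply: lt_trans lt; rewrite mulr_gt0 ?exprn_gt0 ?ellipse_form_gt0 ?unit_speed.
by rewrite pmulr_rgt0 // mulr_gt0.
Qed.

Lemma normal_norm_gt0 (P : plane) : ellipse_form a b P = 1 ->
  dot (normal a b P) (normal a b P) != 0.
Proof.
rewrite /dot /normal /ellipse_form /= => E; apply/eqP => /eqP.
rewrite paddr_eq0 -?expr2 ?sqr_ge0 // !expf_eq0 !mulf_eq0 !invr_eq0 (negPf aN) (negPf bN) !orbF.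
move=> /andP[/eqP p1 /eqP p2]; move: E; rewrite p1 p2 expr0n !mul0r addr0 => /esym/eqP.
by rewrite oner_eq0.
Qed.

Definition orbit_of_trajectory : magic_orbit a b.
Proof.
pose N k := normal a b (hit k).
exists (fun k => (pos T k).1) (fun k => (pos T k).2) (fun k => (vel T k).1)
  (fun k => (vel T k).2) (flight T)
  (fun k => 2 * dot (vel T k) (N k) / dot (N k) (N k))
  (fun k => (N k).1) (fun k => (N k).2) => k.
- by rewrite /N /= [RHS]mulrC divfK.
- by rewrite /N /= [RHS]mulrC divfK.
- by rewrite -(flight_hits T k) /ellipse_form /N /=; field; rewrite aN bN.
- have nn := normal_norm_gt0 (flight_hits T k).
  by rewrite (_ : _ + _ = dot (N k) (N k)) ?divfK // /dot !expr2.
- by rewrite pos_after_hit /N /= [a * _]mulrC divfK.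
- by rewrite pos_after_hit /N /= [b * _]mulrC divfK.
- by rewrite vel_after_hit /N /= mulNr.
- by rewrite vel_after_hit /N /= mulNr.
- by rewrite gt_eqF ?flight_gt0.
- have nn := normal_norm_gt0 (flight_hits T k).
  by rewrite mulf_neq0 ?invr_eq0 // mulf_neq0 ?pnatr_eq0 // gt_eqF ?hit_outwards.
Defined.

(** The equation of the dual conic. The covector [(X / c, Y / d)] is orthogonal to the velocity, so
    it is [k (- v2, v1)], and [Z] is [k] times the angular momentum up to sign; [k != 0] because
    [(X, Y, Z)] is nonzero. *)
Lemma caustic_equation beta : has_caustic T beta -> a - beta != 0 -> b - beta != 0 ->
  ((pos T 0).1 * (vel T 0).2 - (pos T 0).2 * (vel T 0).1) ^+ 2
  = (vel T 0).1 ^+ 2 * (b - beta) + (vel T 0).2 ^+ 2 * (a - beta).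
Proof.
move=> /(_ 0%N)[X [Y [Z [XYZ conic tan]]]] c0 d0.
have := unit_speed T 0; move: tan; rewrite /advance /dot /=.
case: (pos T 0) => p1 p2; case: (vel T 0) => v1 v2 /= tan vv.
pose c := a - beta; pose d := b - beta; pose xi := X / c; pose eta := Y / d.
have XE : X = xi * c by rewrite divfK.
have YE : Y = eta * d by rewrite divfK.
have ZE : p1 * xi + p2 * eta = Z.
  by rewrite -(tan 0) /xi /eta; ring.
have vn : v1 * xi + v2 * eta = 0.
  by rewrite -(subrr Z) -{1}(tan 1) -ZE /xi /eta; ring.
pose k := v1 * eta - v2 * xi.
have xiE : xi = - (k * v2).
  apply: subr0_eq; transitivity (xi * (1 - (v1 * v1 + v2 * v2)) + v1 * (v1 * xi + v2 * eta)).
    by rewrite /k; ring.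
  by rewrite vv vn subrr !mulr0 addr0.
have etaE : eta = k * v1.
  apply: subr0_eq; transitivity (eta * (1 - (v1 * v1 + v2 * v2)) + v2 * (v1 * xi + v2 * eta)).
    by rewrite /k; ring.
  by rewrite vv vn subrr !mulr0 addr0.
have kN : k != 0.
  apply: contraNneq XYZ => k0; rewrite XE YE -ZE xiE etaE k0 !mul0r oppr0 !mul0r !mulr0 addr0.
  exact: eqxx.
have conic' : c * xi ^+ 2 + d * eta ^+ 2 = Z ^+ 2.
  by rewrite -conic XE YE -/c -/d; field; rewrite c0 d0.
apply: (mulfI (expf_neq0 2 kN)); transitivity (Z ^+ 2).
  by rewrite -ZE xiE etaE; ring.
by rewrite -conic' xiE etaE /c /d; ring.
Qed.

(** Along the n-th line the form is [1 + A s (s - l)], where [l] is the flight time. Since the start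
    is in the table, [0 <= c <= l]. *)
Lemma periodic_of_shift (n : nat) (c : R) : (0 < n)%N -> vel T n = vel T 0 ->
  advance (pos T n) c (vel T n) = pos T 0 -> n_periodic T n.
Proof.
move=> n0 vn pn; exists c; split=> //.
have on_ellipse : ellipse_form a b (pos T n) = 1.
  case: n n0 {vn pn} => // k _; rewrite pos_after_hit -(flight_hits T k).
  by rewrite /ellipse_form /= sqrrN.
pose B := dot (vel T n) (normal a b (pos T n)); pose A := ellipse_form a b (vel T n).
have A0 : 0 < A by rewrite ellipse_form_gt0 ?unit_speed.
pose l := flight T n; have l0 : 0 < l := flight_gt0 T n.
have BE : 2 * B = - (A * l).
  have := flight_hits T n; rewrite ellipse_advance on_ellipse -/A -/B -/l => /eqP.
  rewrite -subr_eq0 => /eqP E; apply: subr0_eq; apply: (mulfI (lt0r_neq0 l0)).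
  by rewrite mulr0 -[RHS]E; ring.
have form s : ellipse_form a b (advance (pos T n) s (vel T n)) = 1 + A * s * (s - l).
  by rewrite ellipse_advance on_ellipse -/A -/B -mulrA [s * B]mulrC mulrA BE; ring.
have : c * (c - l) <= 0.
  have := start_in_table T; rewrite -pn form gerDl -mulrA pmulr_rle0 //.
move=> cl; have c0 : 0 <= c.
  by rewrite leNgt; apply/negP => c0; move: cl; rewrite nmulr_rle0 // leNgt subr_lt0 (lt_trans c0).
have cle : c <= l.
  rewrite leNgt; apply/negP => lc; have := lt_trans l0 lc => c1.
  by move: cl; rewrite pmulr_rle0 // leNgt subr_gt0 lc.
rewrite c0 lt_neqAle cle andbT /=; apply/eqP => cE.
(* The case [c = l] is excluded: the first flight goes inside, while the line is outside beyond time
   [l]. *)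
have f0 := flight_gt0 T 0; pose d := flight T 0 / 2.
have d0 : 0 < d by rewrite divr_gt0.
have : ellipse_form a b (advance (pos T 0) d (vel T 0)) < 1.
  by apply: flight_interior; rewrite d0 ltr_pdivrMr // ltr_pMr // ltr1n.
have -> : advance (pos T 0) d (vel T 0) = advance (pos T n) (c + d) (vel T n).
  by rewrite -pn -vn /advance /=; congr (_, _); ring.
rewrite form cE -/l gtrDl addrAC subrr add0r ltNge => /negP[].
exact: ltW (mulr_gt0 (mulr_gt0 A0 (addr_gt0 l0 d0)) d0).
Qed.

End Geometry.

(** * The equivalence of periodicity and linear equivalence *)

Lemma pell_at_0 (K : closedFieldType) (e1 e2 e3 : K) (n : nat) (r s : {poly K}) : (0 < n)%N ->
  r ^+ 2 - cubic e1 e2 e3 * s ^+ 2 = 'X^n -> r.[0] ^+ 2 = e1 * e2 * e3 * s.[0] ^+ 2.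
Proof.
move=> n0 /(congr1 (horner^~ 0)); rewrite hornerD hornerN horner_exp hornerM horner_exp.
rewrite hornerXn expr0n (gtn_eqF n0) /cubic !hornerM !hornerD !hornerN !hornerC hornerX !subr0.
exact: subr0_eq.
Qed.

(** [pell_periodic] is applied to the square of [r + s y], that is to [p = r^2 + f s^2] and
    [q = 2 r s]. At the roots of [f], [p] is [r^2], and evenness of [2m] turns [a^(2m)] into
    [(-a)^(2m)]. *)
Lemma pell_root_periodic (K : closedFieldType) (a b beta : K) (o : magic_orbit a b)
    (m : nat) (r s : {poly K}) :
  (2 : K) != 0 -> ov1 o 0 ^+ 2 + ov2 o 0 ^+ 2 = 1 ->
  (ox1 o 0 * ov2 o 0 - ox2 o 0 * ov1 o 0) ^+ 2
    = ov1 o 0 ^+ 2 * (b - beta) + ov2 o 0 ^+ 2 * (a - beta) ->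
  (0 < m)%N -> a != 0 -> b != 0 ->
  r ^+ 2 - cubic a b beta * s ^+ 2 = 'X^(m.*2) -> r.[0] != 0 ->
  exists c, [/\ ov1 o m.*2 = ov1 o 0, ov2 o m.*2 = ov2 o 0,
    ox1 o m.*2 = ox1 o 0 - c * ov1 o 0 & ox2 o m.*2 = ox2 o 0 - c * ov2 o 0].
Proof.
move=> two vv ell m0 a0 b0 pell r0.
have [sr ss] := pell_sizes pell.
have m20 : (0 < m.*2)%N by rewrite double_gt0.
have r0E := pell_at_0 m20 pell.
pose kappa := (lax_u a b (ox1 o 0) (ox2 o 0) (ov1 o 0) (ov2 o 0)).[0]
              + os o 0 * (lax_v a b (ov1 o 0) (ov2 o 0)).[0].
have kE : kappa ^+ 2 = a * b * beta.
  rewrite kappa_sqr (lax_curve vv ell) /cubic.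
  by rewrite !hornerM !hornerD !hornerN !hornerC hornerX !subr0.
(* At 0 the Pell equation reads [r(0)^2 = kappa^2 s(0)^2], so one of the signs of [s] works. *)
wlog ker : s pell ss r0E / r.[0] + s.[0] * kappa = 0 => [wl|].
  have : (r.[0] + s.[0] * kappa) * (r.[0] + (- s).[0] * kappa) = 0.
    by rewrite hornerN mulNr mulrC -subr_sqr r0E exprMn kE; ring.
  move/eqP; rewrite mulf_eq0 => /orP[] /eqP ker; first exact: wl ker.
  by apply: (wl (- s)); rewrite ?sqrrN ?size_polyN ?hornerN // ?sqrrN // -hornerN.
pose f := cubic a b beta.
have sf : size f = 4 by rewrite size_cubic.
have sr2 : (size (r ^+ 2) <= m.*2.+1)%N by have := size_polyMleq r r; rewrite sr expr2; lia.
have sfs : (size (f * s ^+ 2)%R <= m.*2)%N.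
  have [->|sN] := eqVneq s 0; first by rewrite expr0n mulr0 size_poly0.
  move: (sN); rewrite -size_poly_gt0 => sP.
  have := size_polyMleq f (s * s); have := size_polyMleq s s; rewrite sf -expr2.
  by move: ss sP; move: (size (f * _)) (size (s ^+ 2)) (size s); lia.
have root e : f.[e] = 0 -> r.[e] ^+ 2 = e ^+ m.*2.
  move=> fe; rewrite -[RHS]hornerXn -pell hornerD hornerN horner_exp hornerM -/f fe mul0r.
  by rewrite subr0.
have fE e : f.[e] = (a - e) * (b - e) * (beta - e) by rewrite /f /cubic !hornerE.
have pe e : f.[e] = 0 -> (r ^+ 2 + f * s ^+ 2).[e] = e ^+ m.*2.
  by move=> fe; rewrite hornerD horner_exp hornerM fe mul0r addr0 root.
have p0 : (r ^+ 2 + f * s ^+ 2).[0] = 2 * r.[0] ^+ 2.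
  rewrite hornerD !horner_exp hornerM horner_exp fE !subr0 -r0E; ring.
apply: (@pell_periodic _ a b beta two o vv ell m.*2 (r ^+ 2 + f * s ^+ 2) (2%:P * r * s)) => //.
- transitivity ((r ^+ 2 - f * s ^+ 2) ^+ 2); first by rewrite -/f; ring.
  by rewrite pell -exprM muln2.
- by rewrite (leq_trans (size_polyD _ _)) // geq_max sr2 leqW.
- rewrite coefD [(f * _)`__]nth_default // addr0.
  have := congr1 (fun P : {poly K} => P`_(m.*2)) pell.
  by rewrite coefB -/f [(f * _)`__]nth_default // subr0 coefXn eqxx.
- rewrite -mulrA mul_polyC (leq_trans (size_scale_leq _ _)) //.
  by rewrite (leq_trans (size_polyMleq _ _)) // sr; move: ss m0; move: (size s); lia.
- by rewrite p0 mulf_neq0 // expf_neq0.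
- rewrite p0 !hornerM hornerC -/kappa; transitivity (2 * r.[0] * (r.[0] + s.[0] * kappa)).
    by ring.
  by rewrite ker mulr0.
- by rewrite pe ?fE ?subrr ?mul0r // exprNn -signr_odd odd_double mul1r.
by rewrite pe // fE subrr mulr0 mul0r.
Qed.

(** The field and the ordinate [q] are kept abstract: only the embedding of the reals and
    [q^2 = a b beta] matter. *)
Lemma periodic_lin_equiv (R : realType) (a b : R) (hb : 0 < b) (hab : b < a)
    (T : magic_trajectory a b) (beta : R)
    (hbeta : 0 < beta < b \/ b < beta < a) (hT : has_caustic T beta)
    (n : nat) (hn : (0 < n)%N) (K : closedFieldType) (C : {rmorphism R -> K})
    (q : K) (hq : on_curve (C a) (C b) (C beta) (Some (0, q))) :
  n_periodic T n <->
  ~~ odd n /\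
  lin_equiv (<< exist (on_curve (C a) (C b) (C beta)) (Some (0, q)) hq
               : curve_point (C a) (C b) (C beta) >> *+ n)
            (<< point_infinity (C a) (C b) (C beta) >> *+ n).
Proof.
have a0 : 0 < a := lt_trans hb hab.
have beta0 : 0 < beta by case: hbeta => /andP[// h _]; apply: lt_trans h.
have ba : beta < a by case: hbeta => /andP[_ // h]; apply: lt_trans hab.
have bN : b - beta != 0.
  by rewrite subr_eq0; case: hbeta => /andP[h1 h2]; [rewrite gt_eqF|rewrite lt_eqF].
have aN : a - beta != 0 by rewrite subr_eq0 gt_eqF.
have euniq : uniq [:: a; b; beta].
  by rewrite /= !inE negb_or andbT -[b == beta]subr_eq0 bN -[a == beta]subr_eq0 aN gt_eqF.
have e0 : a * b * beta != 0 by rewrite !mulf_neq0 // gt_eqF.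
pose o := orbit_of_trajectory hb hab T.
have vv : ov1 o 0 ^+ 2 + ov2 o 0 ^+ 2 = 1 by rewrite -(unit_speed T 0) /dot !expr2.
have ell := caustic_equation hT aN bN.
have twoR : (2 : R) != 0 by rewrite pnatr_eq0.
have twoC : (2 : K) != 0 by rewrite -(rmorph_nat C 2) fmorph_eq0 pnatr_eq0.
have euniqC : uniq [:: C a; C b; C beta].
  by rewrite -[X in uniq X]/(map C [:: a; b; beta]) map_inj_uniq //; apply: fmorph_inj.
have q2 : q ^+ 2 = C a * C b * C beta by rewrite (eqP hq) !subr0.
have qN : q != 0 by rewrite -sqrf_eq0 q2 -!rmorphM fmorph_eq0.
(* As [r(0)^2 = q^2 s(0)^2], replacing [s] by [- s] where needed turns the condition at [(0, q)]
   into [r(0) != 0]. *)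
have equiv m : (0 < m)%N ->
    lin_equiv (<< exist (on_curve (C a) (C b) (C beta)) (Some (0, q)) hq
                 : curve_point (C a) (C b) (C beta) >> *+ m.*2)
              (<< point_infinity (C a) (C b) (C beta) >> *+ m.*2) <->
    exists r s, r ^+ 2 - cubic (C a) (C b) (C beta) * s ^+ 2 = 'X^(m.*2) /\ r.[0] != 0.
  move=> m0; have E := lin_equiv_pellP twoC euniqC hq qN m0.
  have m20 : (0 < m.*2)%N by rewrite double_gt0.
  apply: (iff_trans E); split=> -[r [s [pell rs]]].
    exists r, s; split=> //; apply: contraNneq rs => r0.
    have /eqP := pell_at_0 m20 pell; rewrite r0 -q2 expr0n -exprMn eq_sym expf_eq0 /=.
    by rewrite mulf_eq0 (negPf qN) /= => /eqP ->; rewrite mul0r subrr.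
  have [rs0|rs0] := eqVneq (r.[0] - s.[0] * q) 0; last by exists r, s.
  exists r, (- s); rewrite sqrrN hornerN mulNr opprK; split=> //.
  by rewrite -(subr0_eq rs0) -mulr2n -mulr_natl mulf_neq0.
split.
- move=> [sg [_ ps vs]].
  have [||||p [Q [pell pa pb p0 [pm sp]]]] :=
      @periodic_pell _ a b beta twoR o vv ell n sg euniq e0 hn.
  + by rewrite /= vs.
  + by rewrite /= vs.
  + by rewrite /= -ps -vs.
  + by rewrite /= -ps -vs.
  have [on pbeta] := pell_parity hb hab hbeta pell p0 pm sp pa pb.
  have nE : n = n./2.*2 by rewrite -[LHS]odd_double_half (negPf on).
  have m0 : (0 < n./2)%N by rewrite -double_gt0 -nE.
  split=> //; rewrite nE; apply/(equiv _ m0); rewrite -nE.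
  pose pC := map_poly C p; pose qC := map_poly C Q.
  have hC z : pC.[C z] = C p.[z] by rewrite horner_map.
  apply: (@pell_square_root _ (C a) (C b) (C beta) n pC qC twoC euniqC hn).
  + have := congr1 (map_poly C) pell.
    rewrite rmorphB rmorphM !rmorphXn /= map_polyX /cubic !rmorphM !rmorphB /= map_polyX.
    by rewrite !map_polyC.
  + by have := hC 0; rewrite rmorph0 => ->; rewrite fmorph_eq0.
  + by rewrite hC pa -(rmorphXn C) exprNn -signr_odd (negPf on) mul1r.
  + by rewrite hC pb -(rmorphXn C).
  by rewrite hC pbeta -(rmorphXn C).
move=> [on]; have nE : n = n./2.*2 by rewrite -[LHS]odd_double_half (negPf on).
have m0 : (0 < n./2)%N by rewrite -double_gt0 -nE.
rewrite {1 2}nE => /(equiv _ m0)[r [s [pell r0]]].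
pose oC := magic_orbit_map C o.
have oE k : [/\ ox1 oC k = C (pos T k).1, ox2 oC k = C (pos T k).2,
    ov1 oC k = C (vel T k).1 & ov2 oC k = C (vel T k).2] by split; reflexivity.
have [x10 x20 v10 v20] := oE 0%N; have [x1n x2n v1n v2n] := oE n.
have vvC : ov1 oC 0 ^+ 2 + ov2 oC 0 ^+ 2 = 1.
  by rewrite v10 v20 -!rmorphXn -rmorphD [X in C X]vv rmorph1.
have ellC : (ox1 oC 0 * ov2 oC 0 - ox2 oC 0 * ov1 oC 0) ^+ 2
    = ov1 oC 0 ^+ 2 * (C b - C beta) + ov2 oC 0 ^+ 2 * (C a - C beta).
  have := congr1 C ell; rewrite x10 x20 v10 v20.
  by rewrite rmorphXn rmorphB rmorphD !rmorphM !rmorphB.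
have [||c] := @pell_root_periodic _ _ _ _ oC n./2 r s twoC vvC ellC m0 _ _ pell r0.
- by rewrite fmorph_eq0 gt_eqF.
- by rewrite fmorph_eq0 gt_eqF.
rewrite -nE x10 x20 v10 v20 x1n x2n v1n v2n => -[/fmorph_inj v1 /fmorph_inj v2 x1E x2E].
have vn : vel T n = vel T 0 by rewrite [LHS]surjective_pairing v1 v2 -surjective_pairing.
(* The shift [c] lies in [K]; as the velocity is a unit vector, [c] is the image of the real scalar
   product of the velocity with the displacement. *)
pose c' := (vel T 0).1 * ((pos T 0).1 - (pos T n).1)
           + (vel T 0).2 * ((pos T 0).2 - (pos T n).2).
have cE : C c' = c.
  rewrite rmorphD !rmorphM !rmorphB x1E x2E -[RHS]mulr1 -vvC v10 v20; ring.
apply: (periodic_of_shift hb hab hn vn (c := c')).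
rewrite vn [RHS]surjective_pairing /advance; congr (_, _); apply: (fmorph_inj C).
  by rewrite rmorphD rmorphM x1E cE subrK.
by rewrite rmorphD rmorphM x2E cE subrK.
Qed.

Theorem theorem3p10 (R : realType) (a b : R) (hb : 0 < b) (hab : b < a)
    (T : magic_trajectory a b) (beta : R)
    (hbeta : 0 < beta < b \/ b < beta < a) (hT : has_caustic T beta)
    (n : nat) (hn : (0 < n)%N) :
  n_periodic T n <->
  ~~ odd n /\
  lin_equiv (<< Q0 a b beta >> *+ n) (<< Qinf a b beta >> *+ n).
Proof.
exact: (periodic_lin_equiv hb hab hbeta hT hn (C := real_complex R) (on_curve_Q0 a b beta)).
Qed.
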